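(* Let $T<\infty$ be any natural number and suppose that either of the following holds: (a) for every $t\in\{0,1,\dots,T\}$, the sequence $\{X_t^{\mathtt A}\}_{\mathtt A\in\mathbb N}$ is marginally $\mathcal C$-weakly convergent to $X_t$, given $X_t$, that is, $$\mathcal P^{\mathtt A}_{X_t^{\mathtt A}|X_t}(\cdot\,|X_t)\xrightarrow[\mathtt A\to\infty]{\mathcal W}\delta_{X_t}(\cdot);$$ (b) for every $t\in\{0,1,\dots,T\}$, the sequence $\{X_t^{\mathtt A}\}_{\mathtt A\in\mathbb N}$ is (marginally) convergent to $X_t$ in probability, that is, $X_t^{\mathtt A}\xrightarrow[\mathtt A\to\infty]{\mathcal P}X_t$. Then, for any free, finite constant $C\ge 1$, there exists a measurable subset $\widehat\Omega_T\subseteq\Omega$ with $$\mathcal P(\widehat\Omega_T)\ge 1-(T+1)^{1-CN}\exp(-CN)$$ such that $$\lim_{\mathtt A\to\infty}\ \sup_{t\in\{0,\dots,T\}}\ \sup_{\omega\in\widehat\Omega_T}\left|\mathcal E^{\mathtt A}(X_t|\mathscr Y_t)-\mathbb E_{\mathcal P}\{X_t|\mathscr Y_t\}\right|(\omega)=0 .$$ In other words, the convergence of the approximate filtering operators is compact in $t\in\mathbb N$ and, with probability at least $1-(T+1)^{1-CN}\exp(-CN)$, uniform in $\omega$.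
   Context: Setting. $(\Omega,\mathscr F,\mathcal P)$ is a complete probability space, $\mathbb N=\{0,1,2,\dots\}$, $N\ge1$ is a fixed integer. The state process $\{X_t\}_{t\in\mathbb N}$ is an arbitrary real-valued process such that each $X_t$ has a law absolutely continuous with respect to Lebesgue measure and $X_t\in\mathcal Z$ almost surely for all $t$, where $\mathcal Z\subset\mathbb R$ is a fixed compact set. The observations are $$\mathbf y_t=\boldsymbol\mu_t(X_t)+\sqrt{\mathbf C_t(X_t)}\,\boldsymbol u_t\in\mathbb R^N,\qquad t\in\mathbb N,$$ where $\{\boldsymbol u_t\}$ is a standard Gaussian white noise process (i.i.d. $\mathcal N(\mathbf 0,\mathbf I_{N\times N})$, independent of the state process), $\boldsymbol\mu_t:\mathcal Z\to\mathbb R^N$ are known functions, $\mathbf C_t(x)=\boldsymbol\Sigma_t(x)+\sigma_\xi^2\mathbf I_{N\times N}$ with $\sigma_\xi^2\ge0$ fixed, and $\boldsymbol\Sigma_t:\mathcal Z\to\mathcal D_{\boldsymbol\Sigma}$ are known, symmetric positive definite valued functions, with $\mathcal D_{\boldsymbol\Sigma}$ a bounded subset of $\mathbb R^{N\times N}$. Thus, conditionally on the state process, the $\mathbf y_t$ are independent with $\mathbf y_t\sim\mathcal N(\boldsymbol\mu_t(X_t),\mathbf C_t(X_t))$. Assumption 1 (boundedness): $\lambda_{inf}=\inf_t\inf_{x\in\mathcal Z}\lambda_{min}(\mathbf C_t(x))>1$, $\lambda_{sup}=\sup_t\sup_{x\in\mathcal Z}\lambda_{max}(\mathbf C_t(x))<\infty$,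 $\mu_{sup}=\sup_t\sup_{x\in\mathcal Z}\|\boldsymbol\mu_t(x)\|_2<\infty$. Assumption 2 (Lipschitz continuity): there are finite constants $K_\mu,K_{\boldsymbol\Sigma}\ge0$ such that for all $t\in\mathbb N$, all $x,y\in\mathcal Z$ and all entries $(i,j)$: $\|\boldsymbol\mu_t(x)-\boldsymbol\mu_t(y)\|_2\le K_\mu|x-y|$ and $|\boldsymbol\Sigma_t^{ij}(x)-\boldsymbol\Sigma_t^{ij}(y)|\le K_{\boldsymbol\Sigma}|x-y|$. Filtrations: $\mathscr Y_t$ is the (completed) $\sigma$-algebra generated by $\mathbf y_0,\dots,\mathbf y_t$, and $\mathscr H_t$ the one generated by $X_0,\mathbf y_0,\dots,X_t,\mathbf y_t$. Change of measure: $\widetilde{\mathcal P}$ is a probability measure on $(\Omega,\mathscr F)$, equivalent to $\mathcal P$, under which the processes $\{X_t\}_{t\in\mathbb N}$ and $\{\mathbf y_t\}_{t\in\mathbb N}$ are statistically independent, $X_t$ is a process with exactly the same dynamics as under $\mathcal P$, and $\mathbf y_t$ is a Gaussian vector white noise process with zero mean and identity covariance matrix. With the $\{\mathscr H_t\}$-adapted process $$\Lambda_t=\prod_{i=0}^t\frac{\exp\left(\frac12\|\mathbf y_i\|_2^2-\frac12(\mathbf y_i-\boldsymbol\mu_i(X_i))^{T}\mathbf C_i(X_i)^{-1}(\mathbf y_i-\boldsymbol\mu_i(X_i))\right)}{\sqrt{\det\mathbf C_i(X_i)}},$$ one has $\mathbb E_{\mathcal P}\{X_t|\mathscr Y_t\}=\mathbb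 E_{\widetilde{\mathcal P}}\{X_t\Lambda_t|\mathscr Y_t\}/\mathbb E_{\widetilde{\mathcal P}}\{\Lambda_t|\mathscr Y_t\}$ for all $t\in\mathbb N$. Approximations: for each $\mathtt A\in\mathbb N$ (the resolution, or approximation parameter), $\{X_t^{\mathtt A}\}_{t\in\mathbb N}$ is a process on $(\Omega,\mathscr F)$ with $X_t^{\mathtt A}\in\mathcal Z$ almost surely which, like the state, is independent of the observations with respect to $\widetilde{\mathcal P}$. $\Lambda_t^{\mathtt A}$ is defined as $\Lambda_t$ with every $X_i$ replaced by $X_i^{\mathtt A}$ (same observations), and the approximate filtering operator is $$\mathcal E^{\mathtt A}(X_t|\mathscr Y_t)=\frac{\mathbb E_{\widetilde{\mathcal P}}\{X_t^{\mathtt A}\Lambda_t^{\mathtt A}|\mathscr Y_t\}}{\mathbb E_{\widetilde{\mathcal P}}\{\Lambda_t^{\mathtt A}|\mathscr Y_t\}},\qquad t\in\mathbb N.$$ $\mathcal C$-weak convergence: $\mathcal P^{\mathtt A}_{X_t^{\mathtt A}|X_t}(\cdot|X_t)$ denotes the regular conditional distribution (under $\mathcal P$) of $X_t^{\mathtt A}$ given $\sigma\{X_t\}$. The convergence $\mathcal P^{\mathtt A}_{X_t^{\mathtt A}|X_t}(\cdot|X_t)\xrightarrow{\mathcal W}\delta_{X_t}(\cdot)$ means that for $\mathcal P$-almost every $\omega$ the probability measures $\mathcal P^{\mathtt A}_{X_t^{\mathtt A}|X_t}(\cdot|X_t(\omega))$ converge weakly, as $\mathtt A\to\infty$, to the Dirac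 measure $\delta_{X_t(\omega)}$, i.e. their values converge on every Borel set whose boundary is null for the limit measure. *)

(* Defs.v *)
From HB Require Import structures.
From mathcomp Require Export all_boot all_order all_algebra finmap.
From mathcomp Require Export all_classical all_reals all_analysis.

Set Implicit Arguments.
Unset Strict Implicit.
Unset Printing Implicit Defensive.

Import Order.TTheory GRing.Theory Num.Theory.
Import numFieldNormedType.Exports.

Local Open Scope classical_set_scope.
Local Open Scope ring_scope.

(* The library norm on matrices is the sup norm. *)
Definition l2norm (R : realType) (N : nat) (v : 'cV[R]_N) : R :=
  Num.sqrt (\sum_(i < N) v i ord0 ^+ 2).

Definition qform (R : realType) (N : nat) (A : 'M[R]_N) (v : 'cV[R]_N) : R :=
  (v^T *m A *m v) ord0 ord0.

Definition sym_posdef (R : realType) (N : nat) (A : 'M[R]_N) : Prop :=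
  A^T = A /\ forall v : 'cV[R]_N, v != 0 -> 0 < qform A v.

Definition sym_possemidef (R : realType) (N : nat) (A : 'M[R]_N) : Prop :=
  A^T = A /\ forall v : 'cV[R]_N, 0 <= qform A v.

(* The (unique) symmetric positive semidefinite square root when it exists,
   in particular when A is symmetric positive definite; 0 otherwise. *)
Definition sqrtmx (R : realType) (N : nat) (A : 'M[R]_N) : 'M[R]_N :=
  xget 0 [set S : 'M[R]_N | sym_possemidef S /\ S *m S = A].

Definition lambda_min (R : realType) (N : nat) (A : 'M[R]_N) : R :=
  inf [set a : R | eigenvalue A a].

Definition lambda_max (R : realType) (N : nat) (A : 'M[R]_N) : R :=
  sup [set a : R | eigenvalue A a].

Definition random_vector d (Omega : measurableType d) (R : realType) (N : nat)
    (v : Omega -> 'cV[R]_N) : Prop :=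
  forall i : 'I_N, measurable_fun setT (fun w => v w i ord0).

(* sigma-algebra generated by the real variables F i, for i in J *)
Definition sigma_gen d (Omega : measurableType d) (R : realType) (I : Type)
    (J : set I) (F : I -> Omega -> R) : set (set Omega) :=
  <<s \bigcup_(i in J) preimage_set_system setT (F i) measurable >>.

(* sigma-algebra generated by the vectors v t, for t in J: the Borel sets of
   R^N are generated by the coordinates. *)
Definition sigma_gen_vec d (Omega : measurableType d) (R : realType) (N : nat)
    (J : set nat) (v : nat -> Omega -> 'cV[R]_N) : set (set Omega) :=
  sigma_gen [set p : nat * 'I_N | J p.1] (fun p w => v p.1 w p.2 ord0).

(* The observation filtration: generated by v 0, ..., v t and completed with
   the P-negligible sets. *)
Definition filtration_vec d (Omega : measurableType d) (R : realType)
    (P : probability Omega R) (N : nat) (v : nat -> Omega -> 'cV[R]_N)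
    (t : nat) : set (set Omega) :=
  <<s sigma_gen_vec [set s | (s <= t)%N] v `|` P.-negligible >>.

Definition indep d (Omega : measurableType d) (R : realType)
    (P : probability Omega R) (G1 G2 : set (set Omega)) : Prop :=
  forall A B, G1 A -> G2 B -> (P (A `&` B) = P A * P B)%E.

Definition mutual_indep d (Omega : measurableType d) (R : realType)
    (P : probability Omega R) (I : choiceType) (J : set I)
    (G : I -> set (set Omega)) : Prop :=
  forall (K : {fset I}) (E : I -> set Omega),
    (forall i, i \in K -> J i /\ G i (E i)) ->
    (P (\bigcap_(i in [set` K]) E i) = \prod_(i <- K) P (E i))%E.

(* N(0, I): independent N(0, 1) coordinates *)
Definition std_normal_vector d (Omega : measurableType d) (R : realType)
    (P : probability Omega R) (N : nat) (v : Omega -> 'cV[R]_N) : Prop :=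
  (forall (i : 'I_N) (B : set R), measurable B ->
     P ((fun w => v w i ord0) @^-1` B) = normal_prob 0 1 B) /\
  mutual_indep P [set: 'I_N]
    (fun i => preimage_set_system setT (fun w => v w i ord0) measurable).

Definition std_gaussian_white_noise d (Omega : measurableType d)
    (R : realType) (P : probability Omega R) (N : nat) (J : set nat)
    (v : nat -> Omega -> 'cV[R]_N) : Prop :=
  (forall t, J t -> std_normal_vector P (v t)) /\
  mutual_indep P J (fun t => sigma_gen_vec [set t] v).

(* g is a version of the conditional expectation of f given the
   sub-sigma-algebra G. *)
Definition is_cond_expectation d (Omega : measurableType d) (R : realType)
    (P : probability Omega R) (G : set (set Omega)) (f g : Omega -> R) : Prop :=
  [/\ P.-integrable setT (EFin \o f),
      P.-integrable setT (EFin \o g),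
      forall B : set R, measurable B -> G (g @^-1` B) &
      forall A, G A ->
        (\int[P]_(w in A) (g w)%:E = \int[P]_(w in A) (f w)%:E)%E].

Definition cvg_in_probability d (Omega : measurableType d) (R : realType)
    (P : probability Omega R) (Xn : nat -> Omega -> R) (X : Omega -> R) : Prop :=
  forall e : R, 0 < e ->
    P [set w | e <= `|Xn n w - X w|] @[n --> \oo] --> 0%E.

(* k x B is P(Y in B | X = x). *)
Definition is_regular_cond_distribution d (Omega : measurableType d)
    (R : realType) (P : probability Omega R) (Y X : Omega -> R)
    (k : R.-pker R ~> R) : Prop :=
  forall B D : set R, measurable B -> measurable D ->
    (P (X @^-1` D `&` Y @^-1` B) = \int[P]_(w in X @^-1` D) k (X w) B)%E.

Definition weakly_converges (R : realType) (m : nat -> set R -> \bar R)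
    (m0 : set R -> \bar R) : Prop :=
  forall B : set R, measurable B -> m0 (closure B `\` B°) = 0%E ->
    m n B @[n --> \oo] --> m0 B.

(* The regular conditional distribution is a.s. unique, so that the choice of
   the versions is immaterial. *)
Definition Cweakly_convergent d (Omega : measurableType d) (R : realType)
    (P : probability Omega R) (Xn : nat -> Omega -> R) (X : Omega -> R) : Prop :=
  exists k : nat -> R.-pker R ~> R,
    (forall n, is_regular_cond_distribution P (Xn n) X (k n)) /\
    {ae P, forall w, weakly_converges (fun n => k n (X w)) \d_(X w)}.

Definition likelihood_factor (R : realType) (N : nat) (m : 'cV[R]_N)
    (C : 'M[R]_N) (y : 'cV[R]_N) : R :=
  expR (2^-1 * l2norm y ^+ 2 - 2^-1 * qform (invmx C) (y - m))
  / Num.sqrt (\det C).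

Definition Lambda (Omega : Type) (R : realType) (N : nat)
    (mu : nat -> R -> 'cV[R]_N) (C : nat -> R -> 'M[R]_N)
    (y : nat -> Omega -> 'cV[R]_N) (x : nat -> Omega -> R) (t : nat)
    (w : Omega) : R :=
  \prod_(i < t.+1) likelihood_factor (mu i (x i w)) (C i (x i w)) (y i w).

(* f is a version of the ratio E_Pt{x_t Lambda_t | Y_t} / E_Pt{Lambda_t | Y_t},
   with Lambda computed along the process x: with x := X the right-hand side of
   Bayes' formula, with x := X^A the approximate filter. *)
Definition is_filter_ratio d (Omega : measurableType d) (R : realType)
    (P Pt : probability Omega R) (N : nat)
    (mu : nat -> R -> 'cV[R]_N) (C : nat -> R -> 'M[R]_N)
    (y : nat -> Omega -> 'cV[R]_N) (x : nat -> Omega -> R) (t : nat)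
    (f : Omega -> R) : Prop :=
  exists num den : Omega -> R,
    [/\ is_cond_expectation Pt (filtration_vec P y t)
          (fun w => x t w * Lambda mu C y x t w) num,
        is_cond_expectation Pt (filtration_vec P y t)
          (Lambda mu C y x t) den &
        {ae Pt, forall w, f w = num w / den w}].

(* Pt is a reference measure on the time horizon {0, ..., T}.  Over an infinite
   horizon such a Pt cannot exist when the eigenvalues of C are bounded below
   by a constant larger than 1: by the strong law of large numbers, the laws of
   (y_t)_t under P and under Pt would be mutually singular. Any Pt having
   these properties over all times has them on every finite horizon. *)
Record change_of_measure d (Omega : measurableType d) (R : realType)
    (P : probability Omega R) (N : nat)
    (mu : nat -> R -> 'cV[R]_N) (C : nat -> R -> 'M[R]_N)
    (X : nat -> Omega -> R) (y : nat -> Omega -> 'cV[R]_N)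
    (T : nat) (Pt : probability Omega R) : Prop := ChangeOfMeasure {
  com_dom : Pt `<< P ;
  com_dom_rev : P `<< Pt ;
  com_indep : indep Pt (sigma_gen [set t | (t <= T)%N] X)
                       (sigma_gen_vec [set t | (t <= T)%N] y) ;
  (* same dynamics of X: same law of the process (X_0, ..., X_T) *)
  com_law : forall E, sigma_gen [set t | (t <= T)%N] X E -> Pt E = P E ;
  com_noise : std_gaussian_white_noise Pt [set t | (t <= T)%N] y ;
  com_bayes : forall (t : nat) (e f : Omega -> R), (t <= T)%N ->
    is_cond_expectation P (filtration_vec P y t) (X t) e ->
    is_filter_ratio P Pt mu C y X t f ->
    {ae P, forall w, e w = f w}
}.

(* Main.v *)
Require Import Defs.
From mathcomp Require Import measurable_realfun ring lra.

Set Implicit Arguments.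
Unset Strict Implicit.
Unset Printing Implicit Defensive.

Import Order.TTheory GRing.Theory Num.Theory.
Import numFieldNormedType.Exports.

Local Open Scope classical_set_scope.
Local Open Scope ring_scope.

(* Both filters are evaluated in closed form. Under the reference measure the
   state process is independent of the observations, so conditioning on the
   latter freezes them: with Lambda(z, w) the likelihood along the path z for
   the observations at w, the numerator of a filter at w is the integral over
   w' of x_t(w') Lambda(x(w'), w), and similarly for the denominator. For fixed
   w, Lambda(., w) is bounded and uniformly continuous on the paths with values
   in the compact set Z, and the approximations converge in probability under
   the reference measure, so the filters converge at almost every w. As the
   probability allowed for the exceptional set is positive, Egorov's theorem
   upgrades this to uniform convergence for all t <= T.

   Bayes' formula can only be applied once X_t Lambda_t is known to be
   integrable. As C(x) has bounded entries, C(x)^-1 >= I / K in the order of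
   quadratic forms, hence the likelihood is at most
   b exp((1/2 - a) |y|^2) with a > 0, which is integrable for the standard
   Gaussian law. *)

(** * Determinant, inverse and quadratic forms *)

(** The filters are given only as versions, up to null sets that depend on the time and the
    resolution. The closed forms exist at every outcome, so convergence is proved pointwise first
    and countably many null sets are discarded at the end.

    A likelihood is a function of a whole path of the state. Its expectation is handled without a
    sigma-algebra on paths: the state is approximated by processes with finitely many paths, for
    which freezing is a finite computation, and uniform continuity controls the error.

    Convergence in probability is assumed under the original measure and used under the reference
    measure. The epsilon-delta form of absolute continuity carries it over. Hypothesis (a) is first
    reduced to (b), by testing weak convergence on complements of small balls around finitely many
    points of the state space.

    The constant K comes from the entries of C(x), which are bounded because they are continuous on
    a compact set. No spectral decomposition enters. *)

Lemma cvg_det (R : realType) (T : Type) (F : set_system T) (FF : Filter F)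
    (n : nat) (A : T -> 'M[R]_n) (B : 'M[R]_n) :
  (forall i j, A t i j @[t --> F] --> B i j) ->
  \det (A t) @[t --> F] --> \det B.
Proof.
move=> AB; rewrite /determinant.
apply: (@cvg_big R _ +%R) => [|s _]; first exact: add_continuous.
apply: cvgM; first exact: cvg_cst.
apply: (@cvg_big R _ *%R) => [|i _]; [exact: mul_continuous|exact: AB].
Qed.

(** By Cramer's rule an entry of the inverse is a cofactor divided by the determinant, both
    continuous in the entries. *)
Lemma cvg_invmx (R : realType) (T : Type) (F : set_system T) (FF : Filter F)
    (n : nat) (A : T -> 'M[R]_n) (B : 'M[R]_n) :
  (\forall t \near F, A t \in unitmx) -> B \in unitmx ->
  (forall i j, A t i j @[t --> F] --> B i j) ->
  forall i j, invmx (A t) i j @[t --> F] --> invmx B i j.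
Proof.
move=> uA uB AB i j.
have := uB; rewrite unitmxE unitfE => dB.
have -> : invmx B i j = (\det B)^-1 * cofactor B j i.
  by rewrite /invmx uB 2!mxE.
apply: (@cvg_trans _ ((\det (A t))^-1 * cofactor (A t) j i @[t --> F])).
  apply: near_eq_cvg; apply: filterS uA => t uAt.
  by rewrite /invmx uAt 2!mxE.
apply: cvgM; first by apply: cvgV => //; exact: cvg_det.
rewrite /cofactor; apply: cvgM; first exact: cvg_cst.
apply: cvg_det => k l; rewrite !mxE; under eq_fun do rewrite !mxE.
exact: AB.
Qed.

Lemma qformE (R : realType) (n : nat) (A : 'M[R]_n) (v : 'cV[R]_n) :
  qform A v = \sum_i \sum_j v i ord0 * A i j * v j ord0.
Proof.
rewrite /qform mxE exchange_big; apply: eq_bigr => j _ /=.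
by rewrite mxE mulr_suml; apply: eq_bigr => i _; rewrite mxE.
Qed.

Lemma l2norm_sqr (R : realType) (n : nat) (v : 'cV[R]_n) :
  l2norm v ^+ 2 = \sum_i v i ord0 ^+ 2.
Proof. by rewrite sqr_sqrtr// sumr_ge0// => i _; exact: sqr_ge0. Qed.

Lemma coord_le_l2norm (R : realType) (n : nat) (v : 'cV[R]_n) i :
  `|v i ord0| <= l2norm v.
Proof.
rewrite -sqrtr_sqr ler_wsqrtr// (bigD1 i)//= lerDl sumr_ge0// => j _.
exact: sqr_ge0.
Qed.

Lemma posdef_unit (R : realType) (n : nat) (A : 'M[R]_n) :
  (forall v : 'cV[R]_n, v != 0 -> 0 < qform A v) -> A \in unitmx.
Proof.
move=> Apos; rewrite unitmxE unitfE; apply/negP => /det0P[v v0 vA].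
have := Apos v^T; rewrite trmx_eq0 => /(_ v0).
by rewrite /qform trmxK vA mul0mx mxE ltxx.
Qed.

(* The determinant does not vanish along the segment from the identity to A,
   hence it keeps the sign of \det 1. *)
Lemma posdef_det_gt0 (R : realType) (n : nat) (A : 'M[R]_n) :
  (forall v : 'cV[R]_n, v != 0 -> 0 < qform A v) -> 0 < \det A.
Proof.
move=> Apos; rewrite ltNge; apply/negP => detA.
(* The segment is a matrix of polynomials in its parameter, so its determinant is a polynomial and
   [poly_ivt] yields a zero [s] in [0, 1]. There the quadratic form is a convex combination of the
   squared norm of [v] and of [qform A v], hence positive. *)
pose M : 'M[{poly R}]_n := map_mx polyC 1%:M + 'X *: map_mx polyC (A - 1%:M).
have Mx (s : R) : (\det M).[s] = \det (1%:M + s *: (A - 1%:M)).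
  rewrite -[LHS]/(horner_eval s _) -det_map_mx; congr (\det _).
  by apply/matrixP => i j; rewrite /M !mxE /= /horner_eval !hornerE.
have [||s /andP[s0 s1]] := @poly_ivt _ (- \det M) 0 1; first exact: ler01.
  rewrite !hornerN !Mx scale0r addr0 det1 scale1r addrCA subrr addr0.
  by rewrite oppr_le0 ler01 oppr_ge0.
rewrite rootN /root Mx => /eqP det0.
suff : 1%:M + s *: (A - 1%:M) \in unitmx by rewrite unitmxE det0 unitr0.
apply: posdef_unit => v v0.
have v2 : 0 < \sum_i v i ord0 ^+ 2.
  have [i vi0] : exists i, v i ord0 != 0.
    apply/existsP; apply: contraNT v0 => /existsPn v0.
    by apply/eqP/colP => i; rewrite mxE; apply/eqP/negPn/v0.
  rewrite (bigD1 i)//= ltr_pwDl//; first by rewrite exprn_even_gt0.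
  by rewrite sumr_ge0// => j _; exact: sqr_ge0.
have -> : qform (1%:M + s *: (A - 1%:M)) v =
    (1 - s) * (\sum_i v i ord0 ^+ 2) + s * qform A v.
  rewrite !qformE !mulr_sumr -big_split; apply: eq_bigr => i _ /=.
  rewrite mulr_sumr.
  have -> : v i ord0 ^+ 2 = \sum_j v i ord0 * (i == j)%:R * v j ord0.
    rewrite (bigD1 i)//= eqxx mulr1 big1 ?addr0 ?expr2// => j ji.
    by rewrite eq_sym (negbTE ji) mulr0 mul0r.
  rewrite mulr_sumr -big_split; apply: eq_bigr => j _ /=.
  by rewrite !mxE; ring.
have qA := Apos _ v0.
have [s00|s00] := eqVneq s 0; first by rewrite s00 subr0 mul1r mul0r addr0.
rewrite ltr_wpDl// ?mulr_ge0 ?subr_ge0 ?(ltW v2)//.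
by rewrite mulr_gt0// lt_neqAle eq_sym s00.
Qed.

(** Heine's theorem through near-coverings: [P d x] holds for [d] near 0 on the right, locally in
    [x], and compactness makes this uniform over [Z]. Limits are taken within [Z] because the
    coefficients are arbitrary outside it. *)
Lemma compact_uniform_continuous (R : realType) (Z : set R) (f : R -> R) :
  compact Z -> (forall x, Z x -> f @ within Z (nbhs x) --> f x) ->
  forall e, 0 < e -> exists2 d, 0 < d &
    forall x x', Z x -> Z x' -> `|x - x'| < d -> `|f x - f x'| < e.
Proof.
move=> /compact_near_coveringP/near_covering_withinP Zc fc e e0.
have e20 : 0 < e / 2 by rewrite divr_gt0.
pose P (d : R) x := forall x', Z x' -> `|x - x'| < d -> `|f x - f x'| < e.
have : \forall d \near 0^'+, Z `<=` P d.
  apply: Zc => x Zx.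
  have /cvgrPdist_lt/(_ _ e20) := fc x Zx.
  rewrite near_withinE => /nbhs_ballP[d /= d0 xd].
  have d20 : 0 < d / 2 by rewrite divr_gt0.
  exists (ball x (d / 2), [set r : R | 0 < r < d / 2]) => /=.
    split; first exact: nbhsx_ballx.
    near=> r; apply/andP; split; near: r; first exact: nbhs_right_gt.
    exact: nbhs_right_lt.
  move=> [x1 r]/= [xx1 /andP[r0 rd]] Zx1 x2 Zx2 x12.
  have h1 : `|f x - f x1| < e / 2.
    apply: xd => //; apply: (@le_ball _ _ _ (d / 2)) => //.
    by rewrite ler_pdivrMr// ler_peMr ?ltW// ltr1n.
  have h2 : `|f x - f x2| < e / 2.
    apply: xd => //; rewrite /ball/= in xx1 *.
    rewrite (le_lt_trans (ler_distD x1 _ _))// [ltRHS]splitr ltrD//.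
    exact: lt_trans rd.
  rewrite (le_lt_trans (ler_distD (f x) _ _))// [ltRHS]splitr ltrD//.
  by rewrite distrC.
move=> [d /= d0 dP]; exists (d / 2); first by rewrite divr_gt0.
move=> x x' Zx Zx' xx'; apply: (dP (d / 2)) => //=; last first.
  by rewrite divr_gt0.
rewrite sub0r normrN ger0_norm ?divr_ge0 ?ltW//.
by rewrite ltr_pdivrMr// ltr_pMr// ltr1n.
Unshelve. all: by end_near. Qed.

Lemma compact_continuous_bounded (R : realType) (Z : set R) (f : R -> R) :
  compact Z -> (forall x, Z x -> f @ within Z (nbhs x) --> f x) ->
  exists2 B, 0 < B & forall x, Z x -> `|f x| <= B.
Proof.
move=> Zc fc.
have cf : {within Z, continuous f} by apply/subspace_continuousP.
have /compact_bounded[M [_ MB]] := continuous_compact cf Zc.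
exists (Num.max M 0 + 1) => [|x Zx].
  by rewrite ltr_wpDl// le_max lexx orbT.
by apply: (MB (Num.max M 0 + 1)); [rewrite ltr_pwDr// le_max lexx|exists x].
Qed.

(** Each cross term is bounded by 2 |v_i v_j| <= v_i^2 + v_j^2. This crude bound stands in for one
    by the largest eigenvalue. *)
Lemma qform_le (R : realType) (n : nat) (A : 'M[R]_n) (B : R) :
  (forall i j, `|A i j| <= B) ->
  forall v : 'cV[R]_n, qform A v <= B * n%:R * \sum_i v i ord0 ^+ 2.
Proof.
move=> AB v; rewrite qformE.
have -> : B * n%:R * \sum_i v i ord0 ^+ 2 =
    \sum_i \sum_j B * (2^-1 * (v i ord0 ^+ 2 + v j ord0 ^+ 2)).
  pose S := \sum_j v j ord0 ^+ 2.
  transitivity (\sum_(i < n) B * (2^-1 * (v i ord0 ^+ 2 * n%:R + S))).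
    rewrite -!mulr_sumr big_split/= -mulr_suml -/S sumr_const card_ord.
    by rewrite -[S *+ n]mulr_natr; field.
  apply: eq_bigr => i _; rewrite -!mulr_sumr big_split/= sumr_const card_ord.
  by rewrite mulr_natr.
apply: ler_sum => i _; apply: ler_sum => j _.
rewrite (le_trans (ler_norm _))// !normrM mulrAC mulrC.
have B0 : 0 <= B by exact: le_trans (AB i j).
apply: ler_pM => //.
rewrite -[v i ord0 ^+ 2]real_normK ?num_real//.
rewrite -[v j ord0 ^+ 2]real_normK ?num_real//.
set p := `|v i _|; set q := `|v j _|.
have := sqr_ge0 (p - q); rewrite sqrrB; nra.
Qed.

(* Expands 0 <= (v - K w)^T A (v - K w) at w = A^-1 v. *)
Lemma qform_invmx_ge (R : realType) (n : nat) (A : 'M[R]_n) (K : R) :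
  sym_posdef A -> 0 < K ->
  (forall v : 'cV[R]_n, qform A v <= K * \sum_i v i ord0 ^+ 2) ->
  forall v : 'cV[R]_n, K^-1 * \sum_i v i ord0 ^+ 2 <= qform (invmx A) v.
Proof.
move=> [Asym Apos] K0 AK v.
have uA := posdef_unit Apos.
pose w := invmx A *m v.
have Aw : A *m w = v by rewrite mulKVmx.
have wA : w^T *m A = v^T by rewrite -{1}Asym -trmx_mul Aw.
have vv : (v^T *m v) ord0 ord0 = \sum_i v i ord0 ^+ 2.
  by rewrite mxE; apply: eq_bigr => i _; rewrite mxE expr2.
have qw : qform (invmx A) v = (v^T *m w) ord0 ord0 by rewrite /qform -mulmxA.
have q0 : 0 <= qform A (v - K *: w).
  have [->|/Apos/ltW//] := eqVneq (v - K *: w) 0.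
  by rewrite /qform mulmx0 mxE.
have qE : qform A (v - K *: w) = qform A v - K *+ 2 * (\sum_i v i ord0 ^+ 2)
    + K ^+ 2 * qform (invmx A) v.
  have mE : (v - K *: w)^T *m A *m (v - K *: w) =
      v^T *m A *m v - K *: (v^T *m v) - (K *: (v^T *m v) - (K * K) *: (v^T *m w)).
    have -> : (v - K *: w)^T *m A = v^T *m A - K *: v^T.
      by rewrite linearB/= linearZ/= mulmxBl -scalemxAl wA.
    rewrite mulmxBl !mulmxBr -!scalemxAr -!scalemxAl -[v^T *m A *m w]mulmxA Aw.
    by rewrite scalerA.
  have -> : qform A (v - K *: w) = qform A v - K * (v^T *m v) ord0 ord0 -
     (K * (v^T *m v) ord0 ord0 - K * K * (v^T *m w) ord0 ord0).
    rewrite /qform mE; move: (v^T *m A *m v) (v^T *m v) (v^T *m w) => a b c.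
    by rewrite !mxE.
  by rewrite vv qw; ring.
have := AK v; rewrite qE in q0; rewrite ler_pdivrMl//.
move: q0; set q := qform (invmx A) v; set s := \sum_i _; set a := qform A v.
move=> q0 aK.
(* The expansion reads a - 2 K s + K^2 q >= 0, and a <= K s. *)
have : 0 <= K * (K * q - s) by nra.
by rewrite pmulr_rge0// subr_ge0.
Qed.

(** * The likelihood factor *)

Section likelihood.
Context (R : realType) (N : nat) (Z : set R) (m : R -> 'cV[R]_N)
  (C : R -> 'M[R]_N).
Hypotheses (Zc : compact Z)
  (mc : forall i x, Z x -> m x' i ord0 @[x' --> within Z (nbhs x)] --> m x i ord0)
  (Cc : forall i j x, Z x -> C x' i j @[x' --> within Z (nbhs x)] --> C x i j)
  (Cpos : forall x, Z x -> sym_posdef (C x)).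

Lemma likelihood_gt0 x y : Z x -> 0 < likelihood_factor (m x) (C x) y.
Proof.
move=> Zx; rewrite divr_gt0 ?expR_gt0// sqrtr_gt0.
by apply: posdef_det_gt0; case: (Cpos Zx).
Qed.

Lemma det_cvg_within x : Z x ->
  \det (C x') @[x' --> within Z (nbhs x)] --> \det (C x).
Proof. by move=> Zx; apply: cvg_det => i j; exact: Cc. Qed.

Lemma sqrt_det_cvg_within x : Z x ->
  (Num.sqrt (\det (C x')))^-1 @[x' --> within Z (nbhs x)] -->
    (Num.sqrt (\det (C x)))^-1.
Proof.
move=> Zx; apply: cvgV.
  by rewrite gt_eqF// sqrtr_gt0 posdef_det_gt0//; case: (Cpos Zx).
exact: (continuous_cvg _ (@sqrt_continuous _ _) (det_cvg_within Zx)).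
Qed.

Lemma likelihood_cvg_within y x : Z x ->
  likelihood_factor (m x') (C x') y @[x' --> within Z (nbhs x)] -->
    likelihood_factor (m x) (C x) y.
Proof.
move=> Zx; rewrite /likelihood_factor; apply: cvgM; last first.
  exact: sqrt_det_cvg_within.
apply: (continuous_cvg _ (@continuous_expR _ _)).
apply: cvgB; first exact: cvg_cst.
apply: cvgM; first exact: cvg_cst.
rewrite qformE; under eq_fun do rewrite qformE.
apply: (@cvg_big R _ +%R) => [|i _]; first exact: add_continuous.
apply: (@cvg_big R _ +%R) => [|j _]; first exact: add_continuous.
have ym k : (y - m x') k ord0 @[x' --> within Z (nbhs x)] --> (y - m x) k ord0.
  rewrite !mxE; under eq_fun do rewrite !mxE.
  by apply: cvgB; [exact: cvg_cst|exact: mc].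
apply: cvgM; last exact: ym.
apply: cvgM; first exact: ym.
apply: cvg_invmx.
- rewrite near_withinE; apply: nearW => z Zz.
  by apply: posdef_unit; case: (Cpos Zz).
- by apply: posdef_unit; case: (Cpos Zx).
- by move=> k l; exact: Cc.
Qed.

Lemma entries_bounded (I : finType) (f : I -> R -> R) :
  (forall i x, Z x -> f i @ within Z (nbhs x) --> f i x) ->
  exists2 B, 0 < B & forall i x, Z x -> `|f i x| <= B.
Proof.
move=> fc.
have /choice[B BP] : forall i, exists B, 0 < B /\ forall x, Z x -> `|f i x| <= B.
  by move=> i; have [b b0 bP] := compact_continuous_bounded Zc (fc i); exists b.
exists (1 + \sum_i B i).
  by rewrite ltr_wpDr// sumr_ge0// => i _; rewrite ltW//; case: (BP i).
move=> i x Zx; have [_ /(_ _ Zx)/le_trans->//] := BP i.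
rewrite (bigD1 i)//= addrCA lerDl addr_ge0// sumr_ge0// => j _.
by rewrite ltW//; case: (BP j).
Qed.

(** With K an upper bound for C(x) as a quadratic form, C(x)^-1 >= 1/K, and |y - m|^2 >= |y|^2 / 2 -
    M where M bounds |m|^2. The exponent is then at most (1/2 - 1/(4K)) |y|^2 + M/(2K), which
    explains [a] and [b]. The bound is a product over coordinates so that their independence can be
    exploited. *)
Lemma likelihood_le : exists a b : R, [/\ 0 < a, 0 <= b &
  forall x y, Z x -> likelihood_factor (m x) (C x) y <=
    b * \prod_k expR ((2^-1 - a) * y k ord0 ^+ 2)].
Proof.
have [Bm Bm0 mB] := entries_bounded mc.
have [BC BC0 CB] := @entries_bounded ('I_N * 'I_N)%type
  (fun ij x => C x ij.1 ij.2) (fun ij => Cc (i := ij.1) (j := ij.2)).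
have [Bd Bd0 dB] := compact_continuous_bounded Zc sqrt_det_cvg_within.
(* The added 1 keeps [K] positive even in dimension 0. *)
pose K : R := BC * N%:R + 1.
have K0 : 0 < K by rewrite ltr_wpDl// mulr_ge0// ltW.
pose M := Bm ^+ 2 * N%:R.
exists (K^-1 / 4), (expR (K^-1 / 2 * M) * Bd); split.
- by rewrite divr_gt0// invr_gt0.
- by rewrite mulr_ge0// ltW// expR_gt0.
move=> x y Zx; rewrite /likelihood_factor mulrAC.
apply: ler_pM; [exact: expR_ge0|by rewrite invr_ge0 sqrtr_ge0| |]; last first.
  by rewrite (le_trans (ler_norm _))// dB.
rewrite -expR_sum -expRD ler_expR.
have qK v : qform (C x) v <= K * \sum_i v i ord0 ^+ 2.
  rewrite (le_trans (qform_le (fun i j => CB (i, j) x Zx) v))//.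
  rewrite ler_wpM2r ?lerDl// sumr_ge0// => i _; exact: sqr_ge0.
have := qform_invmx_ge (Cpos Zx) K0 qK (y - m x).
have : 2^-1 * (\sum_i y i ord0 ^+ 2) - M <= \sum_i (y - m x) i ord0 ^+ 2.
  have -> : M = \sum_(i < N) Bm ^+ 2 by rewrite sumr_const card_ord -mulr_natr.
  rewrite mulr_sumr -sumrB; apply: ler_sum => i _; rewrite !mxE.
  have : m x i ord0 ^+ 2 <= Bm ^+ 2.
    by rewrite -real_normK ?num_real// lerXn2r ?nnegrE ?(ltW Bm0)// mB.
  (* (p - q)^2 >= p^2 / 2 - q^2 is half of (p - 2q)^2 >= 0. *)
  set p := y i ord0; set q := m x i ord0; have := sqr_ge0 (p - q *+ 2).
  by rewrite !expr2; nra.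
rewrite l2norm_sqr -mulr_sumr.
set q := qform _ _; set s := \sum_i _; set s' := \sum_i _ => h1 h2.
have h3 : K^-1 * (2^-1 * s - M) <= q.
  by apply: le_trans h2; rewrite ler_wpM2l// invr_ge0 ltW.
lra.
Qed.

Lemma likelihood_measurable d (T : measurableType d) (y : T -> 'cV[R]_N) x :
  (forall i, measurable_fun [set: T] (fun w => y w i ord0)) ->
  measurable_fun [set: T] (fun w => likelihood_factor (m x) (C x) (y w)).
Proof.
move=> my; rewrite /likelihood_factor.
under eq_fun do rewrite l2norm_sqr qformE.
apply: measurable_funM; last exact: measurable_cst.
apply: measurableT_comp => //; apply: measurable_funB.
  apply: measurable_funM; first exact: measurable_cst.
  by apply: measurable_sum => i; exact: measurable_funX.
apply: measurable_funM; first exact: measurable_cst.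
apply: measurable_sum => i; apply: measurable_sum => j.
have ym k : measurable_fun [set: T] (fun w => (y w - m x) k ord0).
  under eq_fun do rewrite !mxE.
  by apply: measurable_funB => //; exact: measurable_cst.
apply: measurable_funM => //; apply: measurable_funM => //.
Qed.

End likelihood.

(** * Independence and conditional expectation *)

Section ge0_integral_transfer.
Context d1 (T1 : measurableType d1) d2 (T2 : measurableType d2) (R : realType)
  (Q1 : {measure set T1 -> \bar R}) (Q2 : {measure set T2 -> \bar R}).
Variables (G1 Y1 : T1 -> R) (G2 Y2 : T2 -> R) (c : R).
Hypotheses (mG1 : measurable_fun setT G1) (G10 : forall w, 0 <= G1 w)
  (mY1 : measurable_fun setT Y1)
  (mG2 : measurable_fun setT G2) (G20 : forall w, 0 <= G2 w)
  (mY2 : measurable_fun setT Y2)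
  (GY : forall B, measurable B ->
    (\int[Q1]_(w in Y1 @^-1` B) (G1 w)%:E =
     c%:E * \int[Q2]_(w in Y2 @^-1` B) (G2 w)%:E)%E).
Local Open Scope ereal_scope.
Import HBNNSimple.

(** Hypothesis [GY] compares two image measures on the line: [Q1] with density [G1] pushed along
    [Y1] is [c] times [Q2] with density [G2] pushed along [Y2]. The equality passes from Borel sets
    to nonnegative Borel functions by simple functions and monotone convergence. *)
Let integral_indic_transfer B : measurable B ->
  \int[Q1]_w (G1 w * \1_B (Y1 w))%:E =
  c%:E * \int[Q2]_w (G2 w * \1_B (Y2 w))%:E.
Proof.
have E d (T : measurableType d) (Q : {measure set T -> \bar R}) (G Y : T -> R) :
    \int[Q]_w (G w * \1_B (Y w))%:E = \int[Q]_(w in Y @^-1` B) (G w)%:E.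
  rewrite [RHS]integral_mkcond; apply: eq_integral => w _.
  rewrite patchE indicE; have [|] := boolP (Y w \in B).
    by rewrite in_setE => YB; rewrite mem_set// mulr1.
  by rewrite mulr0 notin_setE => YB; rewrite memNset.
by move=> mB; rewrite !E GY.
Qed.

Let integral_nnsfun (h : {nnsfun R >-> R}) d (T : measurableType d)
    (Q : {measure set T -> \bar R}) (G Y : T -> R) :
  measurable_fun setT G -> (forall w, (0 <= G w)%R) -> measurable_fun setT Y ->
  \int[Q]_w (G w * h (Y w))%:E = \sum_(r \in range h)
    r%:E * \int[Q]_w (G w * \1_(h @^-1` [set r]) (Y w))%:E.
Proof.
move=> mG G0 mY.
have hE s : h s = (\sum_(r \in range h) r * \1_(h @^-1` [set r]) s)%R.
  exact: fimfunE.
have mhr r : measurable (h @^-1` [set r]) by exact: measurable_sfunP.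
have mI r : measurable_fun setT (fun w => \1_(h @^-1` [set r]) (Y w) : R).
  by apply: measurableT_comp => //; exact: measurable_indic.
have fin : finite_set (range h) by exact: fimfunP.
(* A level with a nonempty fibre is a value of [h], hence nonnegative; an empty fibre makes the term
   vanish. So the sign holds for every real [r]. *)
have ind0 r x : h @^-1` [set r] !=set0 -> (0 <= r * \1_(h @^-1` [set r]) x)%R.
  by move=> [s <-]; rewrite mulr_ge0.
have r0 r x : (0 <= r * \1_(h @^-1` [set r]) x)%R.
  have [/ind0//|/nonemptyPn ->] := pselect (h @^-1` [set r] !=set0).
  by rewrite indic0 mulr0.
transitivity (\int[Q]_w
   (\sum_(r \in range h) (r * (G w * \1_(h @^-1` [set r]) (Y w)))%:E)).
  apply: eq_integral => w _; rewrite fsumEFin// hE; congr EFin.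
  rewrite !fsbig_finite//= big_distrr/=; apply: eq_bigr => r _.
  by rewrite mulrCA.
have Gr0 r w : (0 <= r * (G w * \1_(h @^-1` [set r]) (Y w)))%R.
  by rewrite mulrCA mulr_ge0.
rewrite ge0_integral_fsum//; last 2 first.
- move=> r; apply/measurable_EFinP; apply: measurable_funM => //.
  exact: measurable_funM.
- by move=> r w _; rewrite lee_fin.
apply: eq_fsbigr => r; rewrite inE => -[s _ <-].
have hs0 : (0 <= h s)%R by [].
under eq_integral do rewrite EFinM.
rewrite ge0_integralZl//.
- by apply: measurableT_comp => //; exact: measurable_funM.
- by move=> w _; rewrite lee_fin mulr_ge0.
Qed.

Let integral_nnsfun_transfer (h : {nnsfun R >-> R}) :
  \int[Q1]_w (G1 w * h (Y1 w))%:E = c%:E * \int[Q2]_w (G2 w * h (Y2 w))%:E.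
Proof.
have fin : finite_set (range h) by exact: fimfunP.
rewrite !integral_nnsfun// !fsbig_finite//=.
rewrite !big_seq ge0_sume_distrr; last first.
  move=> r; rewrite in_fset_set// inE => -[s _ <-].
  by rewrite mule_ge0 ?lee_fin// integral_ge0// => w _; rewrite lee_fin mulr_ge0.
apply: eq_bigr => r _; rewrite integral_indic_transfer; first by rewrite muleCA.
exact: measurable_sfunP.
Qed.

(* Covers both the product rule for independent variables (Y2 = Y1, G2 = 1) and
   the passage to a density (Y2 = id, G2 the density). *)
Lemma ge0_integral_transfer (h : R -> R) : measurable_fun setT h ->
  (forall s, (0 <= h s)%R) ->
  \int[Q1]_w (G1 w * h (Y1 w))%:E = c%:E * \int[Q2]_w (G2 w * h (Y2 w))%:E.
Proof.
move=> mh h0.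
have mh' : measurable_fun setT (EFin \o h) by exact/measurable_EFinP.
pose h_ := nnsfun_approx measurableT mh'.
have h_cvg s : (h_ n s)%:E @[n --> \oo] --> (h s)%:E.
  by apply: (@cvg_nnsfun_approx _ _ _ setT measurableT _ mh') => // x _;
    rewrite lee_fin.
have h_nd m n s : (m <= n)%N -> (h_ m s <= h_ n s)%R.
  by move=> mn; exact/lefP/nd_nnsfun_approx.
have lim d (T : measurableType d) (Q : {measure set T -> \bar R}) (G Y : T -> R) :
    measurable_fun setT G -> (forall w, (0 <= G w)%R) -> measurable_fun setT Y ->
    \int[Q]_w (G w * h_ n (Y w))%:E @[n --> \oo] -->
    \int[Q]_w (G w * h (Y w))%:E.
  move=> mG G0 mY.
  have -> : \int[Q]_w (G w * h (Y w))%:E =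
      \int[Q]_w limn (fun n => (G w * h_ n (Y w))%:E).
    apply: eq_integral => w _; apply/esym/cvg_lim => //=.
    under eq_fun do rewrite EFinM.
    by rewrite EFinM; apply: cvgeZl.
  apply: cvg_monotone_convergence => //.
  - move=> n; apply/measurable_EFinP; apply: measurable_funM => //.
    exact: measurableT_comp.
  - by move=> n w _; rewrite lee_fin mulr_ge0.
  - by move=> w _ m n mn; rewrite lee_fin ler_wpM2l// h_nd.
have l1 := lim _ _ Q1 G1 Y1 mG1 G10 mY1.
have l2 := cvgeZl (y := c%:E) isT (lim _ _ Q2 G2 Y2 mG2 G20 mY2).
have E : (fun n => \int[Q1]_w (G1 w * h_ n (Y1 w))%:E) =
    (fun n => c%:E * \int[Q2]_w (G2 w * h_ n (Y2 w))%:E).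
  by apply/funext => n; rewrite integral_nnsfun_transfer.
by rewrite E in l1; exact: (cvg_unique _ l1 l2).
Qed.

End ge0_integral_transfer.

Section sub_sigma_algebra.
Context d (T : measurableType d) (R : realType) (Q : probability T R).
Variable gen : set (set T).
Hypothesis G_meas : <<s gen >> `<=` @measurable _ T.
Local Notation T' := (g_sigma_algebraType gen).
Local Notation G := <<s gen >>.

(** Measurability for the sub-sigma-algebra becomes measurability on the type [T'] that carries it,
    where the closure properties under sums, products and limits apply. *)
Lemma sub_measurableP (f : T -> R) :
  (forall B, measurable B -> G (f @^-1` B)) <->
  measurable_fun [set: T'] (f : T' -> R).
Proof.
split=> [Gf _ B mB|mf B mB]; first by rewrite setTI; exact: Gf.
by have := mf measurableT _ mB; rewrite setTI.
Qed.

Lemma sub_measurable_measurable (f : T -> R) :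
  measurable_fun [set: T'] (f : T' -> R) -> measurable_fun [set: T] f.
Proof.
by move=> /sub_measurableP Gf _ B mB; rewrite setTI; apply: G_meas; exact: Gf.
Qed.

(** Independence says that the law of [f] weighted by the indicator of [F] is [Q F] times the law of
    [f]. The transfer lemma applies to the positive and the negative part. *)
Lemma integral_indep (F : set T) (f : T -> R) : measurable F ->
  (forall A, G A -> Q (F `&` A) = Q F * Q A)%E ->
  measurable_fun [set: T'] (f : T' -> R) -> Q.-integrable setT (EFin \o f) ->
  (\int[Q]_(w in F) (f w)%:E = Q F * \int[Q]_w (f w)%:E)%E.
Proof.
move=> mF FG mf' fi.
have mf := sub_measurable_measurable mf'.
have QF : Q F = (fine (Q F))%:E by rewrite fineK// fin_num_measure.
have FY B : measurable B ->
    (\int[Q]_(w in f @^-1` B) (\1_F w)%:E =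
     (fine (Q F))%:E * \int[Q]_(w in f @^-1` B) (cst 1 w)%:E)%E.
  move=> mB; have GB : G (f @^-1` B) by exact: (sub_measurableP _).2.
  have mfB := G_meas GB.
  rewrite (integral_indic Q mfB mF).
  by rewrite (integral_cst Q mfB 1) mul1e -QF; exact: FG.
have key (h : R -> R) : measurable_fun setT h -> (forall s, 0 <= h s) ->
    (\int[Q]_(w in F) (h (f w))%:E = Q F * \int[Q]_w (h (f w))%:E)%E.
  move=> mh h0; transitivity (\int[Q]_w (\1_F w * h (f w))%:E)%E.
    rewrite [LHS]integral_mkcond; apply: eq_integral => w _.
    by rewrite patchE indicE; case: ifPn => _; rewrite ?mul1r ?mul0r.
  rewrite (ge0_integral_transfer (G2 := cst 1) _ _ mf _ _ mf FY)//.
  by rewrite QF; congr (_ * _)%E; apply: eq_integral => w _; rewrite mul1r.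
have pE (D : set T) : (\int[Q]_(w in D) (EFin \o f)^\+ w =
    \int[Q]_(w in D) (Num.max (f w) 0%R)%:E)%E.
  by apply: eq_integral => w _; rewrite funeposE/= EFin_max.
have nE (D : set T) : (\int[Q]_(w in D) (EFin \o f)^\- w =
    \int[Q]_(w in D) (Num.max (- f w)%R 0%R)%:E)%E.
  by apply: eq_integral => w _; rewrite funenegE/= EFin_max.
have E (D : set T) : (\int[Q]_(w in D) (f w)%:E =
    \int[Q]_(w in D) (Num.max (f w) 0%R)%:E
    - \int[Q]_(w in D) (Num.max (- f w)%R 0%R)%:E)%E.
  by rewrite -pE -nE -integralE.
rewrite [LHS]E [in RHS]E.
rewrite (key (fun s => Num.max s 0)); last 2 first.
- by apply: measurable_maxr => //; exact: measurable_cst.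
- by move=> s; rewrite le_max lexx orbT.
rewrite (key (fun s => Num.max (- s) 0)); last 2 first.
- by apply: measurable_maxr => //; exact: measurable_cst.
- by move=> s; rewrite le_max lexx orbT.
have pfin : (\int[Q]_w (Num.max (f w) 0%R)%:E)%E \is a fin_num.
  by rewrite -pE; apply: integrable_fin_num => //; exact: integrable_funepos.
by rewrite [RHS]muleBr// ?fin_num_measure ?fin_num_adde_defr.
Qed.

(** The set where [g'] < [g] belongs to [G], so [g] and [g'] have the same integral over it; a
    positive difference with zero integral forces that set to be null. *)
Let cond_expectation_le (f f' g g' : T -> R) :
  is_cond_expectation Q G f g -> is_cond_expectation Q G f' g' ->
  {ae Q, forall w, f w = f' w} -> {ae Q, forall w, g w <= g' w}.
Proof.
move=> [fi gi Gg fg] [f'i g'i Gg' f'g'] ff'.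
pose A := [set w | g' w < g w].
have GA : G A.
  have mg : measurable_fun [set: T'] (g : T' -> R) by exact/sub_measurableP.
  have mg' : measurable_fun [set: T'] (g' : T' -> R) by exact/sub_measurableP.
  have -> : A = (g \- g') @^-1` `]0, +oo[.
    by apply/seteqP; split => w /=; rewrite in_itv/= andbT subr_gt0.
  by apply: (sub_measurableP _).2; [exact: measurable_funB|exact: measurable_itv].
have mA := G_meas GA.
have mg : measurable_fun [set: T] (EFin \o g) := measurable_int _ gi.
have mg' : measurable_fun [set: T] (EFin \o g') := measurable_int _ g'i.
have iA h : Q.-integrable setT h -> Q.-integrable A h.
  by move=> hi; apply: integrableS hi.
have : (\int[Q]_(w in A) `|(g w - g' w)%:E| = 0)%E.
  transitivity (\int[Q]_(w in A) ((g w)%:E - (g' w)%:E))%E.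
    apply: eq_integral => w; rewrite inE => Aw.
    by rewrite gee0_abs ?lee_fin ?subr_ge0 ?(ltW Aw)// EFinB.
  rewrite (@integralB _ _ _ _ _ mA (EFin \o g) (EFin \o g'))//; try exact: iA.
  rewrite [X in (X - _)%E]fg// [X in (_ - X)%E]f'g'//.
  rewrite (ae_eq_integral (EFin \o f')) //=.
  - rewrite subee//; apply: integrable_fin_num => //; exact: iA.
  - exact: measurable_int (iA _ fi).
  - exact: measurable_int (iA _ f'i).
  - by apply: filterS ff' => w /= ->.
move/ae_eq_integral_abs => /(_ mA); have : measurable_fun A (EFin \o (g \- g')).
  apply/measurable_EFinP/measurable_funTS.
  by apply: measurable_funB; exact/measurable_EFinP.
move=> /[swap] /[apply]; apply: filterS => w /= gg'; rewrite leNgt.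
apply/negP => Aw; have [] := gg' Aw => /eqP; rewrite subr_eq0 => /eqP gg.
by rewrite gg ltxx in Aw.
Qed.

Lemma cond_expectation_ae_unique (f f' g g' : T -> R) :
  is_cond_expectation Q G f g -> is_cond_expectation Q G f' g' ->
  {ae Q, forall w, f w = f' w} -> {ae Q, forall w, g w = g' w}.
Proof.
move=> fg f'g' ff'; have gg' := cond_expectation_le fg f'g' ff'.
have g'g : {ae Q, forall w, g' w <= g w}.
  by apply: (cond_expectation_le f'g' fg); apply: filterS ff' => w ->.
by apply: filterS2 gg' g'g => w h1 h2; apply/le_anti/andP.
Qed.

(** Completeness makes [f'] measurable. This matters for the likelihood along the original state:
    the coefficients are arbitrary outside the compact set, so it is reached only as an almost sure
    modification. *)
Lemma cond_expectation_ae_eq (f f' g : T -> R) : measure_is_complete Q ->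
  is_cond_expectation Q G f g -> {ae Q, forall w, f w = f' w} ->
  is_cond_expectation Q G f' g.
Proof.
move=> Qc [fi gi Gg fg] ff'.
have ff'E D : ae_eq Q D (EFin \o f) (EFin \o f').
  by apply: filterS ff' => w /= ->.
have mf : measurable_fun setT (EFin \o f) := measurable_int _ fi.
have mf' : measurable_fun setT (EFin \o f').
  exact: (ae_measurable_fun Qc (ff'E _)).
have f'fE (D : set T) : measurable D ->
    (\int[Q]_(w in D) (f' w)%:E = \int[Q]_(w in D) (f w)%:E)%E.
  move=> mD; apply/esym/ae_eq_integral => //; first exact: measurable_funTS.
    exact: measurable_funTS.
split => //; last by move=> A GA; rewrite f'fE; [exact: fg|exact: G_meas].
apply/integrableP; split => //; move/integrableP : fi => [_].
congr (_ < _)%E; apply: ae_eq_integral => //; try exact: measurableT_comp.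
by apply: filterS ff' => w /= ->.
Qed.

End sub_sigma_algebra.

(** * The freezing lemma *)

(* In particular g depends on the coordinates 0, ..., t only. *)
Definition uniformly_continuous_path (R : realType) (Z : set R) (t : nat)
    (g : (nat -> R) -> R) : Prop :=
  forall e, 0 < e -> exists2 r, 0 < r & forall z z' : nat -> R,
    (forall i, Z (z i)) -> (forall i, Z (z' i)) ->
    (forall i, (i <= t)%N -> `|z i - z' i| < r) -> `|g z - g z'| < e.

(** A bounded interval containing [Z] is cut into half-open cells of length [e], indexed by
    truncation; two points of one cell are less than [e] apart. *)
Lemma compact_quantizer (R : realType) (Z : set R) (e : R) :
  compact Z -> Z !=set0 -> 0 < e ->
  exists (m : nat) (c : R -> 'I_m.+1) (r : 'I_m.+1 -> R), [/\
    forall j, exists2 B, measurable B & forall x, Z x -> c x = j <-> B x,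
    forall j, Z (r j) & forall x, Z x -> `|x - r (c x)| < e].
Proof.
move=> Zc [z0 Zz0] e0.
have [M [_ MZ]] := compact_bounded Zc.
pose K := M + 1.
have ZK z : Z z -> - K <= z <= K by move=> /MZ ZM; rewrite -ler_norml ZM// ltrDl.
pose idx (x : R) := Num.truncn ((x + K) / e).
have idx0 x : Z x -> 0 <= (x + K) / e.
  by move=> /ZK/andP[Kx _]; rewrite divr_ge0 ?(ltW e0)//; lra.
pose m := idx K.
have idxm x : Z x -> (idx x < m.+1)%N.
  move=> Zx; rewrite ltnS; apply: le_truncn; rewrite ler_pM2r ?invr_gt0//.
  by rewrite lerD2r; case/andP: (ZK _ Zx).
pose c x : 'I_m.+1 := inord (idx x).
have cE x j : Z x -> c x = j <-> idx x = j.
  move=> Zx; split => [<-|xj]; first by rewrite inordK// idxm.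
  by apply: val_inj => /=; rewrite inordK ?xj.
(* A cell that misses [Z] gets the default [z0], so every representative lies in [Z]. *)
pose r j := xget z0 [set z | Z z /\ c z = j].
exists m, c, r; split=> [j|j|x Zx].
- exists `[j%:R * e - K, j.+1%:R * e - K[%classic; first exact: measurable_itv.
  move=> x Zx; rewrite cE// /= in_itv/= lerBlDr ltrBrDr.
  rewrite -ler_pdivlMr// -ltr_pdivrMr// -truncn_eq ?idx0//.
  by split => /eqP.
- by rewrite /r; case: xgetP => [z _ []|].
- have [Zr cr] : Z (r (c x)) /\ c (r (c x)) = c x.
    by rewrite /r; case: xgetP => [z -> []|/(_ x)/= []].
  have /cE := cr => /(_ Zr); rewrite inordK ?idxm// => ir.
  have /andP[h1 h2] := truncn_itv (idx0 _ Zx).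
  have /andP[h3 h4] := truncn_itv (idx0 _ Zr).
  rewrite -/(idx _) ir in h3 h4; rewrite -/(idx _) in h1 h2.
  move: h1 h2 h3 h4; rewrite -natr1.
  rewrite !ler_pdivlMr// !ltr_pdivrMr// mulrDl mul1r.
  by rewrite ltr_norml; set y := _ * e; lra.
Qed.

Section freezing.
Context d (T : measurableType d) (R : realType) (Q : probability T R).
Context (Z : set R) (t : nat) (x : nat -> T -> R).
Hypotheses (Zc : compact Z) (Z0 : Z !=set0)
  (mx : forall i, measurable_fun setT (x i)) (xZ : forall i w, Z (x i w)).
Local Notation H := (sigma_gen [set i | (i <= t)%N] x).

Lemma sigma_gen_measurable : H `<=` measurable.
Proof.
apply: smallest_sub; first exact: sigma_algebra_measurable.
by move=> _ [i _ [B mB <-]]; exact: mx.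
Qed.

(** An approximation of [x] up to time [t] that takes finitely many paths, each inside [Z] at all
    times. The event selecting a path lies in [H], which is what independence from the observations
    can be applied to. *)
Let quantized (e : R) (q : T -> nat -> R) :=
  (forall w i, (i <= t)%N -> `|x i w - q w i| < e) /\
  exists (I : finType) (k : T -> I) (p : I -> nat -> R),
    [/\ forall w, q w = p (k w), forall j i, Z (p j i) &
        forall j, H (k @^-1` [set j])].

Let quantize (e : R) : 0 < e -> exists q, quantized e q.
Proof.
move=> e0; have [m [c [r [cB rZ rc]]]] := compact_quantizer Zc Z0 e0.
pose k w := [ffun i : 'I_t.+1 => c (x i w)].
(* Beyond time [t], [inord] falls back on index 0, so the path remains in [Z]. *)
pose p (f : {ffun 'I_t.+1 -> 'I_m.+1}) i := r (f (inord i)).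
exists (fun w => p (k w)); split=> [w i it|].
  by rewrite /p ffunE inordK// rc.
exists {ffun 'I_t.+1 -> 'I_m.+1}, k, p; split=> // [j i|f]; first exact: rZ.
have /choice[B BP] : forall j, exists B, measurable B /\
    forall x, Z x -> c x = j <-> B x.
  by move=> j; have [B mB cBj] := cB j; exists B.
have -> : k @^-1` [set f] = \bigcap_(i in [set: 'I_t.+1]) (x i @^-1` B (f i)).
  apply/seteqP; split => [w /= <- i _|w /= wB].
    by rewrite /= ffunE; apply/(BP _).2.
  by apply/ffunP => i; rewrite ffunE; apply/(BP _).2 => //; exact: wB.
have := @fin_bigcap_measurable _ (g_sigma_algebraType
  (\bigcup_(i in [set i | (i <= t)%N]) preimage_set_system setT (x i) measurable)).
apply; first exact: finite_finset.
move=> i _; apply: sub_sigma_algebra; exists i; first by rewrite /= -ltnS.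
by exists (B (f i)); [case: (BP (f i))|rewrite setTI].
Qed.

(** The expansion separates the two outcomes: [w'] enters only through indicators of events of [H],
    and [w] only through [g] at fixed paths. *)
Let quantized_sum e q (g : (nat -> R) -> T -> R) : quantized e q ->
  exists (I : finType) (F : I -> set T) (p : I -> nat -> R),
  [/\ forall j, H (F j), forall j i, Z (p j i) &
   forall w w', g (q w') w = \sum_j \1_(F j) w' * g (p j) w].
Proof.
move=> [_ [I [k [p [qp pZ Hk]]]]].
exists I, (fun j => k @^-1` [set j]), p; split=> // w w'.
rewrite (bigD1 (k w'))//= big1 => [|j jk].
  by rewrite addr0 indicE mem_set// mul1r qp.
rewrite indicE memNset ?mul0r//= => kj; by rewrite kj eqxx in jk.
Qed.

Let quantized_in e q : quantized e q -> forall w i, Z (q w i).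
Proof. by move=> [_ [I [k [p [qp pZ Hk]]]]] w i; rewrite qp. Qed.

Let quantized_measurable e q (g : (nat -> R) -> R) : quantized e q ->
  measurable_fun setT (fun w => g (q w)).
Proof.
move=> /(quantized_sum (fun z _ => g z))[I [F [p [HF _ qE]]]].
under eq_fun do rewrite (qE point).
apply: measurable_sum => j; apply: measurable_funM; last exact: measurable_cst.
by apply: measurable_indic; exact: sigma_gen_measurable.
Qed.

Let quantized_cvg (q : nat -> T -> nat -> R) (g : (nat -> R) -> R) w :
  (forall n, quantized n.+1%:R^-1 (q n)) -> uniformly_continuous_path Z t g ->
  g (q n w) @[n --> \oo] --> g (x ^~ w).
Proof.
move=> qP ug; apply/cvgrPdist_lt => e e0.
have [r r0 gr] := ug e e0.
near=> n; apply: gr => //; first by move=> i; exact: quantized_in (qP n) _ _.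
move=> i it; have [/(_ w i it)/lt_trans + _] := qP n; apply.
by near: n; exact: near_infty_natSinv_lt (PosNum r0).
Unshelve. all: by end_near. Qed.

(** Uniform continuity makes the function the pointwise limit of its values along quantized
    processes of mesh 1/(n+1), each of which is a finite combination of indicators. *)
Lemma ucont_path_measurable (g : (nat -> R) -> R) :
  uniformly_continuous_path Z t g -> measurable_fun setT (fun w => g (x ^~ w)).
Proof.
move=> ug.
have /choice[q qP] : forall n, exists q, quantized n.+1%:R^-1 q.
  by move=> n; apply: quantize; rewrite invr_gt0.
apply: (@measurable_fun_cvg _ _ _ _ (fun n w => g (q n w))) => [n|w _].
  exact: quantized_measurable (qP n).
exact: (@quantized_cvg q g w qP ug).
Qed.

Variable gen : set (set T).
Hypotheses (G_meas : <<s gen >> `<=` @measurable _ T) (HG : indep Q H <<s gen >>).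
Local Notation G := <<s gen >>.
Local Notation T' := (g_sigma_algebraType gen).
Variables (g : (nat -> R) -> T -> R) (D : T -> R).
Hypotheses
  (mg : forall z, (forall i, Z (z i)) -> measurable_fun [set: T'] (g z : T' -> R))
  (gD : forall z w, (forall i, Z (z i)) -> `|g z w| <= D w)
  (ug : forall w, uniformly_continuous_path Z t (g ^~ w))
  (Di : Q.-integrable setT (EFin \o D)).

Let gi z : (forall i, Z (z i)) -> Q.-integrable setT (EFin \o g z).
Proof.
move=> zZ; apply: le_integrable Di => //=.
  by apply/measurable_EFinP; apply: (sub_measurable_measurable G_meas (mg zZ)).
move=> w _ /=; rewrite lee_fin (le_trans (gD _ zZ))//; exact: ler_norm.
Qed.

Let quantized_cond_expectation e q : quantized e q ->
  [/\ measurable_fun setT (fun w => g (q w) w),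
   measurable_fun [set: T'] (fun w : T' => fine (\int[Q]_w' (g (q w') w)%:E)) &
   forall A, G A -> (\int[Q]_(w in A) (fine (\int[Q]_w' (g (q w') w)%:E))%:E =
     \int[Q]_(w in A) (g (q w) w)%:E)%E].
Proof.
move=> qq; have [I [F [p [HF pZ qE]]]] := quantized_sum g qq.
have mF j : measurable (F j) by exact: sigma_gen_measurable.
have QF j : Q (F j) = (fine (Q (F j)))%:E by rewrite fineK// fin_num_measure.
have inE w : (\int[Q]_w' (g (q w') w)%:E =
    (\sum_j fine (Q (F j)) * g (p j) w)%:E)%E.
  transitivity (\int[Q]_w' \sum_j (\1_(F j) w' * g (p j) w)%:E)%E.
    by apply: eq_integral => w' _; rewrite qE sumEFin.
  rewrite integral_sum//; last first.
    move=> j; under eq_fun do rewrite mulrC EFinM.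
    by apply: integrableZl => //; exact: integrable_indic.
  rewrite -sumEFin; apply: eq_bigr => j _.
  under eq_integral do rewrite mulrC EFinM.
  rewrite integralZl//; last exact: integrable_indic.
  by rewrite integral_indic// setIT muleC EFinM -QF.
split.
- under eq_fun do rewrite qE; apply: measurable_sum => j.
  apply: measurable_funM; first exact: measurable_indic.
  exact: (sub_measurable_measurable G_meas (mg (pZ j))).
- under eq_fun do rewrite inE /=; apply: measurable_sum => j.
  by apply: measurable_funM; [exact: measurable_cst|exact: mg].
move=> A GA; have mA := G_meas GA.
have gAi j : Q.-integrable A (EFin \o g (p j)).
  by apply: integrableS (gi (pZ j)).
under eq_integral do rewrite inE /= -sumEFin.
rewrite integral_sum//; last by move=> j; under eq_fun do rewrite EFinM;
  exact: (integrableZl mA _ (gAi j)).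
under [RHS]eq_integral do rewrite qE -sumEFin.
have mgA j : measurable_fun [set: T'] ((\1_A \* g (p j)) : T' -> R).
  apply: measurable_funM; last exact: mg.
  by have := @measurable_indic _ T' R setT A; apply.
have giA j : Q.-integrable setT (EFin \o (\1_A \* g (p j))).
  apply: (le_integrable _ _ _ (gi (pZ j))) => //=.
    by apply/measurable_EFinP; apply: (sub_measurable_measurable G_meas).
  move=> w _ /=; rewrite lee_fin normrM ler_piMl//.
  by rewrite indicE ger0_norm// lern1 leq_b1.
have swap (B : set T) (f : T -> R) (E : set T) : 
    (\int[Q]_(w in B) (\1_E w * f w)%:E = \int[Q]_(w in B `&` E) (f w)%:E)%E.
  rewrite [LHS]integral_mkcond [RHS]integral_mkcond.
  apply: eq_integral => w _; rewrite !patchE in_setI indicE.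
  by case: (w \in B); case: (w \in E); rewrite /= ?mul1r ?mul0r.
rewrite integral_sum//; last first.
  move=> j; apply: (le_integrable _ _ _ (gAi j)) => //=.
    apply/measurable_EFinP; apply: measurable_funM.
      exact/measurable_funTS/measurable_indic.
    apply: measurable_funTS.
    by apply: (sub_measurable_measurable G_meas); exact: mg.
  move=> w _ /=; rewrite lee_fin normrM ler_piMl//.
  by rewrite indicE ger0_norm// lern1 leq_b1.
apply: eq_bigr => j _.
(* The indicators of [A] and [F j] trade places: the domain becomes the event [F j] of [H], and the
   integrand [\1_A \* g (p j)] is measurable for [G]. *)
rewrite swap // setIC -swap //.
rewrite -[RHS]/(\int[Q]_(w in F j) ((\1_A \* g (p j)) w)%:E)%E.
rewrite (integral_indep G_meas (mF j))//; last first.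
  by move=> B GB; exact: HG.
under eq_integral do rewrite EFinM.
rewrite (integralZl mA (gAi j)) -QF; congr (_ * _)%E.
by rewrite swap // setTI.
Qed.

(* For the quantized process both sides are finite sums, which agree by
   integral_indep; dominated convergence then removes the quantization. *)
Lemma freezing_cond_expectation :
  is_cond_expectation Q G (fun w => g (x ^~ w) w)
    (fun w => fine (\int[Q]_w' (g (x ^~ w') w)%:E)).
Proof.
have /choice[q qP] : forall n, exists q, quantized n.+1%:R^-1 q.
  by move=> n; apply: quantize; rewrite invr_gt0.
pose f_ n w := g (q n w) w; pose f w := g (x ^~ w) w.
pose h_ n w := fine (\int[Q]_w' (g (q n w') w)%:E).
pose h w := fine (\int[Q]_w' (g (x ^~ w') w)%:E).
have mf_ n : measurable_fun setT (f_ n).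
  by case: (quantized_cond_expectation (qP n)).
have mh_ n : measurable_fun [set: T'] (h_ n : T' -> R).
  by case: (quantized_cond_expectation (qP n)).
have gq w w' : g (q n w') w @[n --> \oo] --> g (x ^~ w') w.
  exact: (@quantized_cvg q (g ^~ w) w' qP (ug w)).
have f_f w : f_ n w @[n --> \oo] --> f w by exact: gq.
have Dgq n w w' : `|g (q n w') w| <= D w.
  by apply: gD => i; exact: (quantized_in (qP n)).
(* In the inner integral [w] is frozen and the constant [D w] dominates; over [w] the integrable
   function [D] dominates. *)
have h_lim w : (\int[Q]_w' (g (q n w') w)%:E)%E @[n --> \oo] -->
    (\int[Q]_w' (g (x ^~ w') w)%:E)%E /\
    Q.-integrable setT (fun w' => (g (x ^~ w') w)%:E).
  have [|||||gxi _] := @dominated_convergence _ _ _ Q setT measurableT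
    (fun n w' => (g (q n w') w)%:E) (fun w' => (g (x ^~ w') w)%:E)
    (cst (D w)%:E); last by split.
  - move=> n; apply/measurable_EFinP.
    exact: (quantized_measurable (g ^~ w) (qP n)).
  - by apply/measurable_EFinP; exact: (ucont_path_measurable (ug w)).
  - by apply: aeW => w' _; apply: cvg_EFin; [exact: nearW|exact: gq].
  - exact: finite_measure_integrable_cst.
  - by apply: aeW => w' n _; rewrite lee_fin.
have h_le n w : `|h_ n w| <= D w.
  rewrite -lee_fin /h_.
  have gqi : Q.-integrable setT (fun w' => (g (q n w') w)%:E).
    apply: (@le_integrable _ _ _ Q setT measurableT _ (cst (D w)%:E)).
    - by apply/measurable_EFinP; exact: (quantized_measurable (g ^~ w) (qP n)).
    - by move=> w' _; rewrite lee_fin (le_trans (Dgq _ _ _))// ler_norm.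
    - exact: finite_measure_integrable_cst.
  rewrite -abse_EFin fineK; last exact: integrable_fin_num.
  apply: (le_trans (le_abse_integral _ _ _)) => //.
    exact: measurable_int gqi.
  apply: (@le_trans _ _ (\int[Q]_w' cst (D w)%:E w')%E).
    apply: ge0_le_integral => //.
    - by apply: measurableT_comp => //; exact: measurable_int gqi.
    - by move=> w' _; rewrite lee_fin.
  by rewrite integral_cst// [X in (_ * X)%E](probability_setT Q) mule1.
have h_h w : h_ n w @[n --> \oo] --> h w.
  have [+ gxi] := h_lim w; rewrite -[X in _ --> X]fineK; last first.
    exact: integrable_fin_num.
  by move/fine_cvgP => [].
have mf : measurable_fun setT f.
  by apply: (@measurable_fun_cvg _ _ _ _ f_) => // w _; exact: f_f.
have mh : measurable_fun [set: T'] (h : T' -> R).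
  apply: (@measurable_fun_cvg _ T' R setT (h_ : nat -> T' -> R)) => // w _.
have mhT := sub_measurable_measurable G_meas mh.
have DiA A : measurable A -> Q.-integrable A (EFin \o D).
  by move=> mA; apply: integrableS Di.
have f_D n w : `|f_ n w| <= D w by exact: Dgq.
have dom (u_ : nat -> T -> R) (u : T -> R) A : measurable A ->
    (forall n, measurable_fun setT (u_ n)) -> measurable_fun setT u ->
    (forall w, u_ n w @[n --> \oo] --> u w) ->
    (forall n w, `|u_ n w| <= D w) ->
    Q.-integrable A (EFin \o u) /\
    (\int[Q]_(w in A) (u_ n w)%:E)%E @[n --> \oo] --> (\int[Q]_(w in A) (u w)%:E)%E.
  move=> mA mu_ mu u_u u_D.
  have [|||||ui _ uc] := @dominated_convergence _ _ _ Q A mA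
    (fun n => EFin \o u_ n) (EFin \o u) (EFin \o D); last by split.
  - by move=> n; apply/measurable_EFinP; exact: measurable_funTS.
  - by apply/measurable_EFinP; exact: measurable_funTS.
  - by apply: aeW => w _; apply: cvg_EFin; [exact: nearW|exact: u_u].
  - exact: DiA.
  - by apply: aeW => w n _; rewrite lee_fin.
have mh_T n := sub_measurable_measurable G_meas (mh_ n).
split.
- by have [] := dom f_ f setT measurableT mf_ mf f_f f_D.
- by have [] := dom h_ h setT measurableT mh_T mhT h_h h_le.
- exact: (sub_measurableP _ _).2.
move=> A GA; have mA := G_meas GA.
have [_ fc] := dom f_ f A mA mf_ mf f_f f_D.
have [_ hc] := dom h_ h A mA mh_T mhT h_h h_le.
have hf : (fun n => \int[Q]_(w in A) (h_ n w)%:E)%E =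
    (fun n => \int[Q]_(w in A) (f_ n w)%:E)%E.
  apply/funext => n; have [_ _] := quantized_cond_expectation (qP n).
  exact.
by rewrite hf in hc; exact: (cvg_unique _ hc fc).
Qed.

End freezing.

(** * Completion and change of measure *)

Section dominated_probability.
Context d (T : measurableType d) (R : realType) (P Q : probability T R).
Hypothesis QP : Q `<< P.

Lemma negligible_null_dominates A : P.-negligible A -> Q.-negligible A.
Proof.
move=> [N [mN N0 AN]]; exists N; split => //.
by move/null_content_dominatesP : QP; exact.
Qed.

Lemma ae_null_dominates (p : T -> Prop) :
  {ae P, forall w, p w} -> {ae Q, forall w, p w}.
Proof. exact: negligible_null_dominates. Qed.

(** [Q] is finite, so domination takes its epsilon-delta form: small [P]-measure forces small
    [Q]-measure. *)
Lemma null_dominates_cvg0 (F : nat -> set T) : (forall n, measurable (F n)) ->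
  P (F n) @[n --> \oo] --> 0%E -> Q (F n) @[n --> \oo] --> 0%E.
Proof.
move=> mF PF.
have [A [B AB]] := Hahn_decomposition (charge_of_finite_measure Q).
have QP' : charge_of_finite_measure Q `<< P by [].
have Qfin n : Q (F n) \is a fin_num by exact: fin_num_measure.
apply/fine_cvgP; split; first exact: nearW.
apply/cvgrPdist_lt => e e0.
have [r [r0 rP]] := charge_variation_continuous AB QP' e0.
move/fine_cvgP : PF => [_ /cvgrPdist_lt/(_ _ r0)]; apply: filterS => n /=.
rewrite !sub0r !normrN !ger0_norm ?fine_ge0// => Pr.
rewrite -lte_fin fineK//.
apply: (@le_lt_trans _ _ `|charge_of_finite_measure Q (F n)|%E).
  by rewrite gee0_abs.
apply: (le_lt_trans (abse_charge_variation AB (mF n))); apply: rP => //.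
by rewrite -[X in (X < _)%E]fineK ?fin_num_measure// lte_fin.
Qed.

End dominated_probability.

Section completion.
Context d (T : measurableType d) (R : realType) (P : probability T R).
Variable gen : set (set T).
Hypotheses (P_complete : measure_is_complete P)
  (G_meas : <<s gen >> `<=` @measurable _ T).
Local Notation G := <<s gen >>.
Local Notation GP := <<s G `|` P.-negligible >>.

Lemma completion_measurable : GP `<=` measurable.
Proof.
apply: smallest_sub; first exact: sigma_algebra_measurable.
by move=> A [/G_meas//|/P_complete].
Qed.

(** The sets that differ from a member of [G] by a [P]-negligible set form a sigma-algebra
    containing the generators of the completion. *)
Lemma completion_ae A : GP A ->
  exists2 B, G B & P.-negligible ((A `\` B) `|` (B `\` A)).
Proof.
apply: (@smallest_sub _ _ _ [set A | exists2 B, G B &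
  P.-negligible ((A `\` B) `|` (B `\` A))]); last first.
  move=> {}A [GA|nA]; first
    by exists A => //; rewrite setDv setU0; exact: negligible_set0.
  exists set0; first exact: sigma_algebra0.
  by rewrite setD0 set0D setU0.
split.
- exists set0; first exact: sigma_algebra0.
  by rewrite setD0 setU0; exact: negligible_set0.
- move=> {}A [B GB nAB]; exists (setT `\` B); first exact: sigma_algebraCD.
  apply: negligibleS nAB => w /= [[[_ nA] nB]|[[_ nB] nA]].
    by right; split => //; exact: contrapT (fun h => nB (conj I h)).
  by left; split => //; exact: contrapT (fun h => nA (conj I h)).
move=> F /= /(_ _)/cid2-/all_sig2[B GB nFB].
exists (\bigcup_i B i); first exact: sigma_algebra_bigcup.
apply: (negligibleS _ (negligible_bigcup nFB)).
move=> w /= [[[i _ Fw] nB]|[[i _ Bw] nF]]; exists i => //.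
  by left; split=> // Bw; apply: nB; exists i.
by right; split=> // Fw; apply: nF; exists i.
Qed.

(** The completion is taken for [P] and the independence for [Q]. As [Q] is dominated by [P],
    replacing a completed event by its companion in [G] alters no [Q]-probability. *)
Lemma indep_completion (Q : probability T R) (H : set (set T)) : Q `<< P ->
  H `<=` measurable -> indep Q H G -> indep Q H GP.
Proof.
move=> QP Hm HG A B HA GPB; have [B' GB' nB] := completion_ae GPB.
have mA := Hm _ HA; have mB := completion_measurable GPB.
have mB' := G_meas GB'.
have null E : measurable E -> E `<=` (B `\` B') `|` (B' `\` B) -> Q E = 0%E.
  move=> mE EB; apply: measure_negligible => //.
  by apply: negligibleS EB _; exact: negligible_null_dominates nB.
have QBB' (E : set T) : measurable E -> Q (E `&` B) = Q (E `&` B').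
  move=> mE; transitivity (Q (E `&` B `&` B')).
    rewrite (measureDI Q (measurableI _ _ mE mB) mB') [X in (X + _)%E]null.
    - by rewrite add0e.
    - by apply: measurableD => //; exact: measurableI.
    - by move=> w [[_ Bw] nB'w]; left.
  rewrite setIAC [RHS](measureDI Q (measurableI _ _ mE mB') mB).
  rewrite [X in _ = (X + _)%E]null.
  - by rewrite add0e.
  - by apply: measurableD => //; exact: measurableI.
  - by move=> w [[_ B'w] nBw]; right.
by rewrite QBB'// HG//; congr (_ * _)%E; rewrite -[B]setTI QBB' ?setTI.
Qed.

End completion.

(** * Convergence in probability *)

Lemma ae_exists d (T : measurableType d) (R : realType) (P : probability T R)
    (p : T -> Prop) : {ae P, forall w, p w} -> exists w, p w.
Proof.
move=> [M [mM PM pM]]; apply: contrapT => np.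
have : P setT = 0%E.
  apply/eqP; rewrite -measure_le0 -PM le_measure ?inE// => w _.
  by apply: pM => /= pw; apply: np; exists w.
by rewrite probability_setT => /eqP; rewrite onee_eq0.
Qed.

Lemma measurable_dist_ge d (T : measurableType d) (R : realType) (f g : T -> R)
    (e : R) : measurable_fun setT f -> measurable_fun setT g ->
  measurable [set w | e <= `|f w - g w|].
Proof.
move=> mf mg; have : measurable_fun setT (fun w => `|f w - g w|).
  by apply: measurableT_comp => //; exact: measurable_funB.
move/(_ measurableT `[e, +oo[%classic (measurable_itv _)).
rewrite setTI; congr (measurable _).
by apply/seteqP; split=> w /=; rewrite in_itv/= andbT.
Qed.

Lemma path_integrable d (T : measurableType d) (R : realType)
    (Q : probability T R) (Z : set R) (t : nat) (x : nat -> T -> R) :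
  compact Z -> Z !=set0 -> (forall i, measurable_fun setT (x i)) ->
  (forall i w, Z (x i w)) -> forall (g : (nat -> R) -> R) (B : R),
  uniformly_continuous_path Z t g ->
  (forall z, (forall i, Z (z i)) -> `|g z| <= B) ->
  Q.-integrable setT (EFin \o (fun w => g (x ^~ w))).
Proof.
move=> Zc Z0 mx xZ g B ug gB.
apply: (@le_integrable _ _ _ Q setT measurableT _ (cst B%:E)).
- by apply/measurable_EFinP; exact: (ucont_path_measurable Zc Z0 mx xZ ug).
- by move=> w _ /=; rewrite lee_fin (le_trans (gB _ _))// ler_norm.
- exact: finite_measure_integrable_cst.
Qed.

(** Where all coordinates up to [t] are within [r], [g] moves by less than e/2; elsewhere it moves
    by at most 2B, on an event whose probability tends to 0. The function [b] below is this
    pointwise bound. *)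
Lemma expectation_path_cvg d (T : measurableType d) (R : realType)
    (Q : probability T R) (Z : set R) (t : nat)
    (xn : nat -> nat -> T -> R) (x : nat -> T -> R) (g : (nat -> R) -> R) (B : R) :
  compact Z -> Z !=set0 ->
  (forall n i, measurable_fun setT (xn n i)) -> (forall n i w, Z (xn n i w)) ->
  (forall i, measurable_fun setT (x i)) -> (forall i w, Z (x i w)) ->
  (forall i, (i <= t)%N -> cvg_in_probability Q (xn ^~ i) (x i)) ->
  uniformly_continuous_path Z t g ->
  (forall z, (forall i, Z (z i)) -> `|g z| <= B) ->
  (\int[Q]_w (g ((xn n) ^~ w))%:E)%E @[n --> \oo] -->
  (\int[Q]_w (g (x ^~ w))%:E)%E.
Proof.
move=> Zc Z0 mxn xnZ mx xZ xnx ug gB.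
have gi (y : nat -> T -> R) my yZ :=
  @path_integrable _ _ _ Q _ _ y Zc Z0 my yZ g B ug gB.
have B0 : 0 <= B.
  have [z Zz] := Z0; exact: le_trans (normr_ge0 _) (gB (fun=> z) (fun=> Zz)).
have gxi := gi _ mx xZ; have gxni n := gi _ (mxn n) (xnZ n).
rewrite -[X in _ --> X]fineK; last exact: integrable_fin_num gxi.
apply/fine_cvgP; split.
  by apply: nearW => n; apply: integrable_fin_num (gxni n).
apply/cvgrPdist_lt => e e0.
have e20 : 0 < e / 2 by rewrite divr_gt0.
have [r r0 gr] := ug _ e20.
pose E n i := [set w | r <= `|xn n i w - x i w|].
have mE n i : measurable (E n i) by exact: measurable_dist_ge.
have Ecvg : \sum_(i < t.+1) fine (Q (E n i)) @[n --> \oo] --> (0 : R).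
  rewrite [X in _ --> X](_ : 0 = \sum_(i < t.+1) 0); last by rewrite big1.
  apply: (@cvg_big R _ +%R) => [|i _]; first exact: add_continuous.
  have := xnx i (ltn_ord i) r r0.
  by move/fine_cvgP => [].
(* The added 1 keeps the divisor positive when B = 0. *)
have d0 : 0 < e / 2 / (2 * B + 1) by rewrite divr_gt0//; lra.
move/cvgrPdist_lt/(_ _ d0) : Ecvg; apply: filterS => n /=.
have QE0 i : 0 <= fine (Q (E n i)) by rewrite fine_ge0.
rewrite sub0r normrN ger0_norm; last by rewrite sumr_ge0.
move=> En.
rewrite -fineB; last 2 first.
- exact: integrable_fin_num gxi.
- exact: integrable_fin_num (gxni n).
rewrite -integralB_EFin//.
pose b w := (e / 2 + (2 * B) * \sum_(i < t.+1) \1_(E n i) w).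
have mb : measurable_fun setT b.
  apply: measurable_funD; first exact: measurable_cst.
  apply: measurable_funM; first exact: measurable_cst.
  by apply: measurable_sum => i; exact: measurable_indic.
have gb w : `|g (x ^~ w) - g ((xn n) ^~ w)| <= b w.
  have [[i Ei]|nE] := pselect (exists i : 'I_t.+1, E n i w).
    apply: (@le_trans _ _ (2 * B)).
      rewrite (le_trans (ler_normB _ _))// mulr_natl mulr2n lerD//; exact: gB.
    rewrite /b ler_wpDl// ?(ltW e20)// ler_peMr//; first by rewrite mulr_ge0.
    by rewrite (bigD1 i)//= indicE mem_set// lerDl sumr_ge0.
  apply/ltW; rewrite /b (@lt_le_trans _ _ (e / 2))//; last first.
    by rewrite lerDl mulr_ge0 ?mulr_ge0// sumr_ge0.
  apply: gr => // i it; rewrite ltNge distrC; apply/negP => Ei.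
  by apply: nE; exists (Ordinal (it : (i < t.+1)%N)).
have bE : (\int[Q]_w (b w)%:E =
    (e / 2 + 2 * B * \sum_(i < t.+1) fine (Q (E n i)))%:E)%E.
  rewrite /b.
  under eq_integral do rewrite EFinD (EFinM (2 * B)) -sumEFin.
  have Ii i : Q.-integrable setT (EFin \o \1_(E n i) : T -> \bar R).
    exact: integrable_indic.
  have Is : Q.-integrable setT
      (fun w => (\sum_(i < t.+1) (\1_(E n i) w)%:E)%E).
    by apply: integrable_sum => // i _; exact: Ii.
  rewrite integralD//; first last.
  - by apply: integrableZl Is.
  - exact: finite_measure_integrable_cst.
  rewrite (integralZl measurableT Is).
  have Ec : (\int[Q]_w (e / 2)%:E = (e / 2)%:E)%E.
    rewrite -[LHS]/(\int[Q]_w cst (e / 2)%:E w)%E integral_cst//.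
    by rewrite [X in (_ * X)%E](probability_setT Q) mule1.
  rewrite Ec integral_sum; [|exact: measurableT|exact: Ii].
  rewrite [RHS]EFinD; congr (_ + _)%E; rewrite (EFinM (2 * B)); congr (_ * _)%E.
  rewrite -sumEFin; apply: eq_bigr => i _.
  by rewrite integral_indic// setIT fineK// fin_num_measure.
have dI : Q.-integrable setT
    (EFin \o ((fun w => g (x ^~ w)) \- (fun w => g ((xn n) ^~ w)))).
  by have := integrableB measurableT gxi (gxni n).
apply: (@le_lt_trans _ _ (e / 2 + 2 * B * \sum_(i < t.+1) fine (Q (E n i)))).
  rewrite -lee_fin -bE -abse_EFin fineK; last exact: (integrable_fin_num _ dI).
  apply: (le_trans (le_abse_integral _ _ _)) => //; first exact: measurable_int dI.
  apply: ge0_le_integral => //.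
  - by apply: measurableT_comp => //; exact: measurable_int dI.
  - by apply/measurable_EFinP.
  - by move=> w _ /=; rewrite lee_fin; exact: gb.
rewrite [ltRHS]splitr ltrD2l.
move: En; rewrite ltr_pdivlMr; last by lra.
have : 0 <= \sum_(i < t.+1) fine (Q (E n i)) by rewrite sumr_ge0.
set s := \sum_(i < _) _; nra.
Qed.

Lemma measure_bigsetU_le d (T : measurableType d) (R : realType)
    (P : {measure set T -> \bar R}) (I : Type) (s : seq I) (F : I -> set T) :
  (forall i, measurable (F i)) ->
  (P (\big[setU/set0]_(i <- s) F i) <= \sum_(i <- s) P (F i))%E.
Proof.
move=> mF; elim: s => [|i s ih]; first by rewrite !big_nil measure0.
rewrite !big_cons; apply: le_trans (leeD2l _ ih).
by apply: measureU2 => //; exact: bigsetU_measurable.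
Qed.

(* A regular conditional distribution is only tested on rectangles: the event
   e <= |xn - x| is covered by finitely many of them. *)
Lemma Cweak_cvg_in_probability d (T : measurableType d) (R : realType)
    (P : probability T R) (Z : set R) (xn : nat -> T -> R) (x : T -> R) :
  compact Z -> (forall n, measurable_fun setT (xn n)) -> measurable_fun setT x ->
  {ae P, forall w, Z (x w)} ->
  Cweakly_convergent P xn x -> cvg_in_probability P xn x.
Proof.
move=> Zc mxn mx xZae [k [kP kw]] e e0.
have mZ : measurable Z by exact: compact_measurable.
have Z0 : Z !=set0 by have [w Zw] := ae_exists xZae; exists (x w).
have [N0 [mN0 PN0 xZ]] := xZae.
have e20 : 0 < e / 2 by rewrite divr_gt0.
have [m [c [r [cB rZ rc]]]] := compact_quantizer Zc Z0 e20.
have /choice[B BP] : forall j, exists B, measurable B /\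
    forall x, Z x -> c x = j <-> B x.
  by move=> j; have [B mB cBj] := cB j; exists B.
(* If [x] is in cell [j], it is within e/2 of [r j]; hence e <= |xn - x| puts [xn] in [C j], while
   [x] itself stays outside. *)
pose C j := [set y : R | e / 2 <= `|y - r j|].
have mC j : measurable (C j).
  by apply: measurable_dist_ge => //; exact: measurable_cst.
have mE n : measurable [set w | e <= `|xn n w - x w|].
  exact: measurable_dist_ge.
pose F j := x @^-1` (B j `&` Z).
have mpre (f : T -> R) S : measurable_fun setT f -> measurable S ->
    measurable (f @^-1` S).
  by move=> mf mS; rewrite -[X in measurable X]setTI; exact: mf.
have mBZ j : measurable (B j `&` Z) by apply: measurableI => //; case: (BP j).
have mF j : measurable (F j) by exact: mpre.
pose A n j := F j `&` xn n @^-1` C j.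
have mA n j : measurable (A n j) by apply: measurableI => //; exact: mpre.
have PA n j : P (A n j) = (\int[P]_(w in F j) k n (x w) (C j))%E by exact: kP.
have PA0 j : P (A n j) @[n --> \oo] --> 0%E.
  under eq_fun do rewrite PA.
  suff : (\int[P]_(w in F j) k n (x w) (C j))%E @[n --> \oo] -->
      (\int[P]_(w in F j) cst 0 w)%E by rewrite integral0.
  have [|||||_ _] := @dominated_convergence _ _ _ P (F j) (mF j)
    (fun n w => k n (x w) (C j)) (cst 0%E) (cst 1%E); last exact.
  - move=> n; apply: measurable_funTS.
    by apply: (measurableT_comp (measurable_kernel (k n) (C j) (mC j))).
  - exact: measurable_cst.
  - apply: filterS kw => w kw [Bx Zx] /=.
    have nC : `|x w - r j| < e / 2.
      by have cx := (BP j).2 _ Zx; move: (rc _ Zx); rewrite cx.2.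
    have nCj : ~ C j (x w) by rewrite /C/= leNgt nC.
    (* A closed set contains its boundary, so the boundary misses [x w] and [C j] is an admissible
       test set for the Dirac limit. *)
    have clC : closed (C j).
      have -> : C j = (fun y : R => `|y - r j|) @^-1` [set y | e / 2 <= y] by [].
      apply: closed_comp; last exact: closed_ge.
      by move=> y _; apply: cvg_norm; apply: cvgB => //; exact: cvg_cst.
    have d0 : \d_(x w) (C j) = 0%E :> \bar R by rewrite diracE memNset.
    have d1 : \d_(x w) (closure (C j) `\` (C j)^°) = 0%E :> \bar R.
      by rewrite diracE memNset// => -[+ _]; rewrite -(closure_id (C j)).1.
    by have := kw (C j) (mC j) d1; rewrite d0.
  - exact: finite_measure_integrable_cst.
  - apply: aeW => w n Fw; rewrite gee0_abs// /cst.
    by rewrite -(prob_kernel (s := k n) (x w)) le_measure ?inE.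
pose S n := \sum_(j < m.+1) fine (P (A n j)).
have S0 : S n @[n --> \oo] --> \sum_(j < m.+1) (0 : R).
  apply: (@cvg_big R _ +%R) => [|j _]; first exact: add_continuous.
  by have /fine_cvgP[] := PA0 j.
rewrite big1// in S0.
apply: (@squeeze_cvge _ _ _ _ (cst 0%E) _ (EFin \o S)); first 2 last.
- by apply: cvg_EFin => //; exact: nearW.
- apply: nearW => n; rewrite measure_ge0/=.
  have SE : (S n)%:E = (\sum_(j < m.+1) P (A n j))%E.
    by rewrite -sumEFin; apply: eq_bigr => j _; rewrite fineK// fin_num_measure.
  have mU : measurable (\big[setU/set0]_(j < m.+1) A n j).
    exact: bigsetU_measurable.
  rewrite SE; apply: (le_trans _ (measure_bigsetU_le P _ (mA n))).
  (* The null set [N0], where [x] may leave [Z], completes the cover at no cost. *)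
  rewrite -(measureU0 mU mN0 PN0) le_measure ?inE//.
  + exact: measurableU.
  + move=> w /= ew; have [Nw|Nw] := pselect (N0 w); [by right|left].
    have Zxw : Z (x w) by apply: contrapT => nZ; apply: Nw; exact: xZ.
    rewrite (bigD1 (c (x w)))//=; left.
    split; first by split=> //; apply/(BP _).2.
    rewrite /C/=; have := rc _ Zxw; rewrite leNgt; set a := r _ => h1.
    apply/negP => h2; move: ew; rewrite leNgt => /negP; apply.
    by rewrite (le_lt_trans (ler_distD a _ _))// [ltRHS]splitr ltrD// distrC.
- exact: cvg_cst.
Qed.

(** * Gaussian integrability *)

(* Up to a constant the integrand is the density of N(0, 1 / (2 a)). *)
Lemma integral_normal_pdf_expR_lty (R : realType) (a : R) : 0 < a ->
  (\int[lebesgue_measure]_s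
     (normal_pdf 0 1 s * expR ((2^-1 - a) * s ^+ 2))%:E < +oo)%E.
Proof.
move=> a0; pose s0 : R := (Num.sqrt (2 * a))^-1.
have s00 : s0 != 0 by rewrite invr_neq0// gt_eqF// sqrtr_gt0 mulr_gt0.
have s0E : s0 ^+ 2 = (2 * a)^-1 by rewrite exprVn sqr_sqrtr// mulr_ge0// ltW.
have p0 := normal_peak_gt0 s00.
pose K := normal_peak 1 / normal_peak s0.
have E (s : R) : normal_pdf 0 1 s * expR ((2^-1 - a) * s ^+ 2) =
    K * normal_pdf 0 s0 s.
  rewrite !normal_pdfE ?oner_neq0// /K mulrA divfK ?gt_eqF// -mulrA.
  congr (_ * _); rewrite /normal_fun -expRD subr0; congr expR.
  by rewrite s0E expr1n; field; rewrite gt_eqF.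
under eq_integral do rewrite E EFinM.
rewrite integralZl//; last exact: integrable_normal_pdf.
by rewrite integral_normal_pdf mule1 ltry.
Qed.

Lemma prod_indic (T : Type) (R : realType) (I : eqType) (L : seq I)
    (Y : I -> T -> R) (B : I -> set R) (w : T) :
  \prod_(p <- L) \1_(B p) (Y p w) =
  \1_(\bigcap_(p in [set` L]) Y p @^-1` B p) w :> R.
Proof.
have [/allP LB|/allPn[p pL nB]] := boolP (all (fun p => Y p w \in B p) L).
  rewrite big1_seq => [|p /andP[_ pL]]; last by rewrite indicE LB.
  by rewrite indicE mem_set// => p /= pL; have := LB p pL; rewrite inE.
rewrite (big_rem p)//= indicE (negbTE nB) mul0r indicE memNset// => LB.
by move: nB; rewrite notin_setE; apply; exact: LB.
Qed.

Section independent_product.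
Context d (T : measurableType d) (R : realType) (Q : probability T R).
Context (I : eqType) (Y : I -> T -> R) (L : seq I).
Hypotheses (L_uniq : uniq L) (mY : forall p, measurable_fun setT (Y p))
  (Y_indep : forall B : I -> set R, (forall p, measurable (B p)) ->
    (Q (\bigcap_(p in [set` L]) Y p @^-1` B p) =
     \prod_(p <- L) normal_prob 0 1 (B p))%E).

Lemma normal_expectation_prod (h : I -> R -> R) (m : I -> R) :
  (forall p, measurable_fun setT (h p)) -> (forall p s, 0 <= h p s) ->
  (forall p, (\int[lebesgue_measure]_s (normal_pdf 0 1 s * h p s)%:E = (m p)%:E)%E) ->
  (\int[Q]_w (\prod_(p <- L) h p (Y p w))%:E = (\prod_(p <- L) m p)%:E)%E.
Proof.
move=> mh h0 hm.
(* The indicators, for which independence is known, are replaced by the h p one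
   coordinate at a time. *)
suff H s1 : forall s2 (B : I -> set R), s1 ++ s2 = L ->
    (forall p, measurable (B p)) ->
    (\int[Q]_w (\prod_(p <- s1) h p (Y p w) * \prod_(p <- s2) \1_(B p) (Y p w))%:E =
    (\prod_(p <- s1) m p * \prod_(p <- s2) fine (normal_prob 0 1 (B p)))%:E)%E.
  have := H L [::] (fun=> setT) (cats0 L) (fun=> measurableT).
  rewrite big_nil mulr1 => <-; apply: eq_integral => w _.
  by rewrite big_nil mulr1.
have nfin (B : set R) : measurable B -> normal_prob 0 1 B \is a fin_num.
  exact: (fin_num_measure (normal_prob 0 1)).
have mI (B : I -> set R) p : measurable (B p) ->
    measurable_fun setT (fun w => \1_(B p) (Y p w) : R).
  by move=> mB; apply: measurableT_comp => //; exact: measurable_indic.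
elim/last_ind: s1 => [s2 B /= -> mB|s1 p ih s2 B sL mB].
  rewrite big_nil mul1r.
  transitivity (Q (\bigcap_(p in [set` L]) Y p @^-1` B p)).
    rewrite -[X in Q X]setIT -[RHS]integral_indic//; last first.
      apply/(@measurable_indicP _ _ R).
      apply: (@eq_measurable_fun _ _ T R setT (fun w => \prod_(p <- L) \1_(B p) (Y p w) : R)).
        by move=> w _; rewrite prod_indic.
      by apply: measurable_prod => p _; exact: mI.
    by apply: eq_integral => w _; rewrite big_nil mul1r prod_indic.
  rewrite Y_indep// -prodEFin; apply: eq_bigr => p _.
  by rewrite fineK//; exact: nfin.
have pL : p \notin s1 ++ s2.
  by move: L_uniq; rewrite -sL cat_rcons -cat1s uniq_catCA /= => /andP[].
pose G1 w := \prod_(q <- s1) h q (Y q w) * \prod_(q <- s2) \1_(B q) (Y q w).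
pose c := \prod_(q <- s1) m q * \prod_(q <- s2) fine (normal_prob 0 1 (B q)).
transitivity (\int[Q]_w (G1 w * h p (Y p w))%:E)%E.
  apply: eq_integral => w _; congr EFin.
  by rewrite -cats1 big_cat big_seq1 /= /G1; ring.
(* The weight [G1] gathers all coordinates other than [p]. By induction, the law of [Y p] weighted
   by [G1] is [c] times the standard normal law. *)
rewrite (@ge0_integral_transfer _ _ _ _ _ Q lebesgue_measure G1 (Y p)
  (normal_pdf 0 1) id c)//.
- by rewrite hm -EFinM -cats1 big_cat big_seq1/=; congr EFin; rewrite /c; ring.
- apply: measurable_funM; apply: measurable_prod => q _; last exact: mI.
  exact: measurableT_comp.
- by move=> w; rewrite /G1 mulr_ge0// prodr_ge0.
- exact: measurable_normal_pdf.
- by move=> s; exact: normal_pdf_ge0.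
move=> B0 mB0; rewrite -[X in _ = (_ * X)%E]/(normal_prob 0 1 B0).
(* As [L] has no duplicates, [p] is not in [s2], so the change at [p] leaves the other indicators
   alone. *)
pose B' q := if q == p then B0 else B q.
have mB' q : measurable (B' q) by rewrite /B'; case: ifP.
have := ih (p :: s2) B' _ mB'; rewrite -cat_rcons => /(_ sL).
have ps2 : p \notin s2 by move: pL; rewrite mem_cat negb_or => /andP[].
have B's2 q : q \in s2 -> B' q = B q.
  by rewrite /B'; case: eqP => // -> ps; rewrite ps in ps2.
have B'p : B' p = B0 by rewrite /B' eqxx.
move=> {}ih.
transitivity (\int[Q]_w (\prod_(q <- s1) h q (Y q w) *
    \prod_(q <- p :: s2) \1_(B' q) (Y q w))%:E)%E.
  rewrite [LHS]integral_mkcond; apply: eq_integral => w _.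
  rewrite big_cons B'p patchE.
  have -> : \prod_(q <- s2) \1_(B' q) (Y q w) = \prod_(q <- s2) \1_(B q) (Y q w) :> R.
    by rewrite !big_seq; apply: eq_bigr => q qs2; rewrite B's2.
  have -> : (w \in Y p @^-1` B0) = (Y p w \in B0) by apply/idP/idP; rewrite !inE.
  by rewrite [X in _ * (X * _)]indicE; case: ifPn => _; rewrite ?mul1r// mul0r mulr0.
rewrite ih big_cons B'p /c.
have -> : \prod_(q <- s2) fine (normal_prob 0 1 (B' q)) =
    \prod_(q <- s2) fine (normal_prob 0 1 (B q)).
  by rewrite !big_seq; apply: eq_bigr => q qs2; rewrite B's2.
rewrite mulrCA EFinM fineK ?nfin// muleC.
by [].
Qed.

End independent_product.

Lemma mutual_indep_seq d (T : measurableType d) (R : realType)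
    (Q : probability T R) (I : choiceType) (J : set I)
    (G : I -> set (set T)) (s : seq I) (E : I -> set T) :
  mutual_indep Q J G -> uniq s -> (forall i, i \in s -> J i /\ G i (E i)) ->
  (Q (\bigcap_(i in [set` s]) E i) = \prod_(i <- s) Q (E i))%E.
Proof.
move=> QG s_uniq sG.
have sK i : (i \in [fset x in s]%fset) = (i \in s) by rewrite !inE.
have Ks : perm_eq [fset x in s]%fset s.
  by apply: uniq_perm; [exact: fset_uniq|exact: s_uniq|exact: sK].
rewrite -(perm_big _ Ks).
rewrite -QG => [|i]; last by rewrite sK; exact: sG.
by congr (Q _); apply: eq_bigcapl; split => i /=; rewrite sK.
Qed.

Section gaussian_noise.
Context d (T : measurableType d) (R : realType) (Q : probability T R).
Context (N t : nat) (J : set nat) (v : nat -> T -> 'cV[R]_N).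
Hypotheses (tJ : forall i, (i <= t)%N -> J i)
  (mv : forall i, random_vector (v i)) (vQ : std_gaussian_white_noise Q J v).
Local Notation I := ('I_t.+1 * 'I_N)%type.

(** Two independences are composed: between times for the whole vectors, and between coordinates at
    a fixed time. *)
Lemma gaussian_noise_indep (B : I -> set R) : (forall p, measurable (B p)) ->
  (Q (\bigcap_(p in [set` index_enum I]) (fun w => v p.1 w p.2 ord0) @^-1` B p) =
   \prod_(p <- index_enum I) normal_prob 0 1 (B p))%E.
Proof.
move=> mB; have [vn vi] := vQ.
(* The noise is indexed by naturals and [B] by ordinals; [inord] is used only for i <= t, where it
   is faithful. *)
pose E i := \bigcap_(k in [set` index_enum 'I_N])
  (fun w => v i w k ord0) @^-1` B (inord i, k).
have QE i : (i <= t)%N ->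
    (Q (E i) = \prod_(k < N) normal_prob 0 1 (B (inord i, k)))%E.
  move=> it; have [vnB vni] := vn i (tJ it).
  rewrite (mutual_indep_seq vni); first last.
  - move=> k _; split => //; exists (B (inord i, k)) => //.
    by rewrite setTI.
  - exact: index_enum_uniq.
  by apply: eq_bigr => k _; rewrite vnB.
have iP i : (i \in iota 0 t.+1) = (i <= t)%N by rewrite mem_iota add0n ltnS.
transitivity (Q (\bigcap_(i in [set` iota 0 t.+1]) E i)).
  congr (Q _); apply/seteqP; split=> w wB.
    move=> i it k _; have {}it : (i <= t)%N by rewrite -iP.
    have := wB (inord i, k); rewrite /= inordK//.
    by apply; rewrite mem_index_enum.
  move=> [i k] _; have iL : (i : nat) \in iota 0 t.+1 by rewrite iP -ltnS.
  by have := wB i iL k; rewrite /= mem_index_enum inord_val; exact.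
rewrite (mutual_indep_seq vi); first last.
- move=> i; rewrite iP => it; split; first exact: tJ.
  have := @fin_bigcap_measurable _ (g_sigma_algebraType
    (\bigcup_(p in [set p : nat * 'I_N | [set i] p.1]) preimage_set_system setT
     (fun w => v p.1 w p.2 ord0) measurable)).
  apply; first exact: finite_finset.
  move=> k _; apply: sub_sigma_algebra; exists (i, k) => //=.
  by exists (B (inord i, k)); [|rewrite setTI].
- exact: iota_uniq.
rewrite -[iota 0 t.+1]/(index_iota 0 t.+1) big_mkord.
transitivity (\prod_(i < t.+1) \prod_(k < N) normal_prob 0 1 (B (i, k)))%E.
  by apply: eq_bigr => i _; rewrite QE -1?ltnS// inord_val.
by rewrite pair_bigA; apply: eq_bigr => -[].
Qed.

Lemma gaussian_noise_integrable (a : nat -> R) : (forall i, 0 < a i) ->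
  Q.-integrable setT (EFin \o (fun w =>
    \prod_(i < t.+1) \prod_k expR ((2^-1 - a i) * v i w k ord0 ^+ 2))).
Proof.
move=> a0; pose h (p : I) s := expR ((2^-1 - a p.1) * s ^+ 2).
have mh p : measurable_fun setT (h p).
  apply: measurableT_comp => //; apply: measurable_funM; first exact: measurable_cst.
  exact: measurable_funX.
pose m p := fine (\int[lebesgue_measure]_s (normal_pdf 0 1 s * h p s)%:E).
have hm p : (\int[lebesgue_measure]_s (normal_pdf 0 1 s * h p s)%:E)%E = (m p)%:E.
  rewrite fineK// ge0_fin_numE; first exact: integral_normal_pdf_expR_lty.
  by apply: integral_ge0 => s _; rewrite lee_fin mulr_ge0 ?normal_pdf_ge0 ?expR_ge0.
pose Y (p : I) w := v p.1 w p.2 ord0.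
have mY p : measurable_fun setT (Y p) by exact: mv.
have E w : \prod_(i < t.+1) \prod_k expR ((2^-1 - a i) * v i w k ord0 ^+ 2) =
    \prod_p h p (Y p w) by rewrite pair_bigA.
apply/integrableP; split.
  apply/measurable_EFinP; rewrite (_ : (fun _ => _) = fun w => \prod_p h p (Y p w)).
    by apply: measurable_prod => p _; exact: measurableT_comp.
  by apply/funext => w; rewrite E.
have h0 w : 0 <= \prod_p h p (Y p w).
  by apply: prodr_ge0 => p _; exact: expR_ge0.
under eq_integral do rewrite /= E ger0_norm ?h0//.
rewrite (normal_expectation_prod (index_enum_uniq _) mY gaussian_noise_indep mh _ hm).
  exact: ltry.
by move=> p s; exact: expR_ge0.
Qed.

End gaussian_noise.

(** * Functions of the state path *)

Section path_functions.
Context (R : realType) (Z : set R) (t : nat).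

(** The bound is strictly positive because the estimate for products divides by it. *)
Definition bounded_path (g : (nat -> R) -> R) : Prop :=
  exists2 B, 0 < B & forall z, (forall i, Z (z i)) -> `|g z| <= B.

Lemma uniformly_continuous_coord (f : R -> R) i : compact Z -> (i <= t)%N ->
  (forall x, Z x -> f @ within Z (nbhs x) --> f x) ->
  uniformly_continuous_path Z t (fun z => f (z i)) /\
  bounded_path (fun z => f (z i)).
Proof.
move=> Zc it fc; split.
  move=> e e0; have [r r0 fr] := compact_uniform_continuous Zc fc e0.
  by exists r => // z z' zZ z'Z zz'; apply: fr => //; exact: zz'.
by have [B B0 fB] := compact_continuous_bounded Zc fc; exists B => // z zZ; exact: fB.
Qed.

Lemma uniformly_continuous_pathM (f g : (nat -> R) -> R) :
  uniformly_continuous_path Z t f /\ bounded_path f ->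
  uniformly_continuous_path Z t g /\ bounded_path g ->
  uniformly_continuous_path Z t (fun z => f z * g z) /\
  bounded_path (fun z => f z * g z).
Proof.
move=> [uf [Bf Bf0 fB]] [ug [Bg Bg0 gB]]; split; last first.
  exists (Bf * Bg) => [|z zZ]; first exact: mulr_gt0.
  by rewrite normrM ler_pM// ?fB// gB.
move=> e e0.
have ef : 0 < e / 2 / Bg by rewrite !divr_gt0.
have eg : 0 < e / 2 / Bf by rewrite !divr_gt0.
have [rf rf0 fr] := uf _ ef; have [rg rg0 gr] := ug _ eg.
exists (Num.min rf rg) => [|z z' zZ z'Z zz']; first by rewrite lt_min rf0.
have -> : f z * g z - f z' * g z' = (f z - f z') * g z + f z' * (g z - g z').
  by ring.
rewrite (le_lt_trans (ler_normD _ _))// !normrM [ltRHS]splitr ltrD//.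
  rewrite (@le_lt_trans _ _ (`|f z - f z'| * Bg))//.
    by rewrite ler_wpM2l// gB.
  rewrite -ltr_pdivlMr//; apply: fr => // i it.
  by have := zz' i it; rewrite lt_min => /andP[].
rewrite (@le_lt_trans _ _ (Bf * `|g z - g z'|))//.
  by rewrite ler_wpM2r// fB.
rewrite mulrC -ltr_pdivlMr//; apply: gr => // i it.
by have := zz' i it; rewrite lt_min => /andP[].
Qed.

Lemma uniformly_continuous_path_prod (I : eqType) (s : seq I)
    (f : I -> (nat -> R) -> R) :
  (forall i, uniformly_continuous_path Z t (f i) /\ bounded_path (f i)) ->
  uniformly_continuous_path Z t (fun z => \prod_(i <- s) f i z) /\
  bounded_path (fun z => \prod_(i <- s) f i z).
Proof.
move=> uf; elim: s => [|i s ih].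
  split.
    by move=> e e0; exists 1 => // z z' _ _ _; rewrite !big_nil subrr normr0.
  by exists 1 => // z _; rewrite big_nil normr1.
under [X in uniformly_continuous_path _ _ X]eq_fun do rewrite big_cons.
under [X in bounded_path X]eq_fun do rewrite big_cons.
exact: uniformly_continuous_pathM.
Qed.

End path_functions.

(** * Lipschitz coefficients and almost sure modifications of processes *)

Lemma lipschitz_cvg_within (R : realType) (Z : set R) (f : R -> R) (K : R) x :
  0 <= K -> (forall x x', Z x -> Z x' -> `|f x - f x'| <= K * `|x - x'|) ->
  Z x -> f x' @[x' --> within Z (nbhs x)] --> f x.
Proof.
move=> K0 fK Zx; apply/cvgrPdist_lt => e e0; rewrite near_withinE.
have K1 : 0 < K + 1 by rewrite ltr_wpDl.
apply/nbhs_ballP; exists (e / (K + 1)) => [|x']/=; first by rewrite divr_gt0.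
rewrite /ball/= ltr_pdivlMr// => xx' Zx'.
rewrite (le_lt_trans (fK _ _ Zx Zx'))// (le_lt_trans _ xx')// mulrC.
by rewrite ler_wpM2l// lerDl.
Qed.

Lemma sym_posdefD_scalar (R : realType) (n : nat) (A : 'M[R]_n) (s : R) :
  0 <= s -> sym_posdef A -> sym_posdef (A + s%:M).
Proof.
move=> s0 [As Ap]; split; first by rewrite linearD /= As tr_scalar_mx.
move=> v v0; rewrite /qform mulmxDr mulmxDl mul_mx_scalar -scalemxAl mxE.
rewrite ltr_pwDl//; first exact: Ap.
rewrite mxE mulr_ge0// mxE sumr_ge0// => i _; rewrite mxE -expr2.
exact: sqr_ge0.
Qed.

Section retraction.
Context d (T : measurableType d) (R : realType).

(* The coefficients are only controlled on Z: processes which are in Z almost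
   surely are moved into Z everywhere. *)
Definition retract (Z : set R) (z0 x : R) : R := if x \in Z then x else z0.

Lemma retract_in (Z : set R) z0 x : Z z0 -> Z (retract Z z0 x).
Proof. by move=> Zz0; rewrite /retract; case: ifPn => //; rewrite inE. Qed.

Lemma retract_id (Z : set R) z0 x : Z x -> retract Z z0 x = x.
Proof. by move=> Zx; rewrite /retract mem_set. Qed.

Lemma measurable_retract (Z : set R) z0 : measurable Z ->
  measurable_fun setT (retract Z z0).
Proof.
move=> mZ; have -> : retract Z z0 = (fun x => \1_Z x * x + (1 - \1_Z x) * z0).
  apply/funext => x; rewrite /retract indicE; case: ifPn => _.
    by rewrite mul1r subrr mul0r addr0.
  by rewrite mul0r add0r subr0 mul1r.
apply: measurable_funD; apply: measurable_funM => //.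
by apply: measurable_funB => //; exact: measurable_indic.
Qed.

(** The retracted process generates a smaller sigma-algebra, and so inherits independence from the
    observations. *)
Lemma sigma_gen_comp (I : Type) (J : set I) (f : R -> R) (x : I -> T -> R) :
  measurable_fun setT f ->
  sigma_gen J (fun i w => f (x i w)) `<=` sigma_gen J x.
Proof.
move=> mf; apply: smallest_sub; first exact: smallest_sigma_algebra.
move=> _ [i Ji [B mB <-]]; apply: sub_sigma_algebra; exists i => //.
by exists (f @^-1` B) => //; rewrite -[X in measurable X]setTI; exact: mf.
Qed.

Lemma sigma_gen_sub (I : Type) (J J' : set I) (x : I -> T -> R) :
  J `<=` J' -> sigma_gen J x `<=` sigma_gen J' x.
Proof.
by move=> JJ'; apply: sub_sigma_algebra2 => A [i Ji xA]; exists i => //; exact: JJ'.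
Qed.

Lemma sigma_gen_vec_measurable (N : nat) (J : set nat) (v : nat -> T -> 'cV[R]_N) :
  (forall i, random_vector (v i)) -> sigma_gen_vec J v `<=` measurable.
Proof.
move=> mv; apply: smallest_sub; first exact: sigma_algebra_measurable.
by move=> _ [p _ [B mB <-]]; exact: mv.
Qed.

End retraction.

(** A zero integral would make [f] vanish almost everywhere, hence at some outcome, since the total
    mass is 1. *)
Lemma expectation_gt0 d (T : measurableType d) (R : realType)
    (Q : probability T R) (f : T -> R) : measurable_fun setT f ->
  (forall w, 0 < f w) -> (0 < \int[Q]_w (f w)%:E)%E.
Proof.
move=> mf f0; rewrite lt_neqAle; apply/andP; split; last first.
  by apply: integral_ge0 => w _; rewrite lee_fin ltW.
apply/negP => /eqP If.
have : (\int[Q]_w `|(f w)%:E| = 0)%E.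
  by rewrite If; apply: eq_integral => w _; rewrite gee0_abs ?lee_fin ?ltW.
have mf' : measurable_fun setT (EFin \o f) by exact/measurable_EFinP.
move=> /(ae_eq_integral_abs Q measurableT mf').
move=> /ae_exists[w /(_ I)[fw0]].
by have := f0 w; rewrite fw0 ltxx.
Qed.

Lemma cvg_in_probability_ae d (T : measurableType d) (R : realType)
    (Q : probability T R) (xn yn : nat -> T -> R) (x y : T -> R) :
  (forall n, measurable_fun setT (xn n)) -> measurable_fun setT x ->
  (forall n, measurable_fun setT (yn n)) -> measurable_fun setT y ->
  (forall n, {ae Q, forall w, xn n w = yn n w}) -> {ae Q, forall w, x w = y w} ->
  cvg_in_probability Q xn x -> cvg_in_probability Q yn y.
Proof.
move=> mxn mx myn my xyn xy xnx e e0.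
have mE (f g : T -> R) : measurable_fun setT f -> measurable_fun setT g ->
    measurable [set w | e <= `|f w - g w|] by exact: measurable_dist_ge.
rewrite (_ : (fun n => _) = (fun n => Q [set w | e <= `|xn n w - x w|])).
  exact: xnx.
apply/funext => n; apply/eqP; rewrite eq_le.
have le (f g f' g' : T -> R) : measurable_fun setT f -> measurable_fun setT g ->
    measurable_fun setT f' -> measurable_fun setT g' ->
    {ae Q, forall w, f w = f' w} -> {ae Q, forall w, g w = g' w} ->
    (Q [set w | (e <= `|f w - g w|)%R] <= Q [set w | (e <= `|f' w - g' w|)%R])%E.
  move=> mf mg mf' mg' [M [mM QM fM]] [M' [mM' QM' gM']].
  have mMM := measurableU _ _ mM mM'.
  have QMM : Q (M `|` M') = 0%E by rewrite null_set_setU.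
  rewrite -(measureU0 (mE _ _ mf' mg') mMM QMM) le_measure ?inE//.
  - exact: mE.
  - by apply: measurableU => //; exact: mE.
  move=> w /= efg; have [Mw|nMw] := pselect (M w); first by right; left.
  have [M'w|nM'w] := pselect (M' w); first by right; right.
  have fw : f w = f' w by apply: contrapT => fw; apply: nMw; exact: fM.
  have gw : g w = g' w by apply: contrapT => gw; apply: nM'w; exact: gM'.
  by left; rewrite /= -fw -gw.
apply/andP; split.
  apply: (le _ _ _ _ (myn n) my (mxn n) mx).
    by apply: filterS (xyn n) => w ->.
  by apply: filterS xy => w ->.
exact: (le _ _ _ _ (mxn n) mx (myn n) my (xyn n) xy).
Qed.

(** * The filters *)

Section filter.
Context (d : measure_display) (Omega : measurableType d) (R : realType)
  (P Q : probability Omega R) (N : nat) (Z : set R)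
  (mu : nat -> R -> 'cV[R]_N) (C : nat -> R -> 'M[R]_N)
  (y : nat -> Omega -> 'cV[R]_N) (T : nat).
Hypotheses (P_complete : measure_is_complete P) (QP : Q `<< P) (PQ : P `<< Q)
  (Zc : compact Z) (Z0 : Z !=set0)
  (muc : forall t i x, Z x ->
     mu t x' i ord0 @[x' --> within Z (nbhs x)] --> mu t x i ord0)
  (Cc : forall t i j x, Z x ->
     C t x' i j @[x' --> within Z (nbhs x)] --> C t x i j)
  (Cpos : forall t x, Z x -> sym_posdef (C t x))
  (y_meas : forall t, random_vector (y t))
  (y_noise : std_gaussian_white_noise Q [set t | (t <= T)%N] y).

(** The path is decoupled from the outcome that fixes the observations; inserting [x ^~ w] for [z]
    gives back the likelihood of the process [x] by conversion. *)
Let Lam t (z : nat -> R) w := Lambda mu C y (fun i _ => z i) t w.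

Lemma Lambda_gt0 t z w : (forall i, Z (z i)) -> 0 < Lam t z w.
Proof.
move=> zZ; rewrite /Lam /Lambda; apply: prodr_gt0 => i _.
exact: (@likelihood_gt0 _ _ Z (mu i) (C i) (@Cpos i) _ _ (zZ i)).
Qed.

Lemma Lambda_uniformly_continuous t w :
  uniformly_continuous_path Z t (Lam t ^~ w) /\ bounded_path Z (Lam t ^~ w).
Proof.
apply: uniformly_continuous_path_prod => i.
apply: (@uniformly_continuous_coord _ _ _
  (fun x => likelihood_factor (mu i x) (C i x) (y i w))) => //.
  by rewrite -ltnS.
by move=> x Zx; exact: (likelihood_cvg_within (muc (t := i)) (Cc (t := i)) (@Cpos i)).
Qed.

Lemma coord_Lambda_uniformly_continuous t w :
  uniformly_continuous_path Z t (fun z => z t * Lam t z w) /\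
  bounded_path Z (fun z => z t * Lam t z w).
Proof.
apply: uniformly_continuous_pathM; last exact: Lambda_uniformly_continuous.
apply: (@uniformly_continuous_coord _ _ _ id) => // x Zx.
by apply: cvg_within_filter.
Qed.

(** The Gaussian bounds have constants depending on the time, but uniform in the state; their
    product over the times up to [t] dominates every path at once. *)
Lemma Lambda_dominated t : (t <= T)%N -> exists D : Omega -> R,
  Q.-integrable setT (EFin \o D) /\
  forall z w, (forall i, Z (z i)) -> `|Lam t z w| <= D w.
Proof.
move=> tT.
have /choice[ab abP] : forall i, exists ab : R * R, [/\ 0 < ab.1, 0 <= ab.2 &
    forall x y, Z x -> likelihood_factor (mu i x) (C i x) y <=
      ab.2 * \prod_k expR ((2^-1 - ab.1) * y k ord0 ^+ 2)].
  move=> i; have [a [b [a0 b0 abP]]] := likelihood_le Zc (muc (t := i))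
    (Cc (t := i)) (@Cpos i).
  by exists (a, b).
exists (fun w => (\prod_(i < t.+1) (ab i).2) *
  \prod_(i < t.+1) \prod_k expR ((2^-1 - (ab i).1) * y i w k ord0 ^+ 2)).
split.
  have := @gaussian_noise_integrable _ _ _ Q N t _ y _ y_meas y_noise
    (fun i => (ab i).1) _.
  move=> /(_ _ _)/(integrableZl measurableT (\prod_(i < t.+1) (ab i).2)); apply.
  - by move=> i it; exact: leq_trans tT.
  - by move=> i; case: (abP i).
move=> z w zZ; rewrite gtr0_norm; last exact: Lambda_gt0.
rewrite -big_split/= /Lam /Lambda; apply: ler_prod => i _.
rewrite ltW ?(@likelihood_gt0 _ _ Z (mu i) (C i) (@Cpos i) _ _ (zZ i))//=.
by have [_ _] := abP i; apply.
Qed.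

(** The underlying type is arbitrary so that the lemma also applies on the type carrying the
    completed observation sigma-algebra. *)
Lemma Lambda_measurable t z d' (T' : measurableType d')
    (v : nat -> T' -> 'cV[R]_N) :
  (forall i k, (i <= t)%N -> measurable_fun setT (fun w => v i w k ord0)) ->
  measurable_fun setT (fun w => Lambda mu C v (fun i _ => z i) t w).
Proof.
move=> mv; apply: measurable_prod => i _; apply: likelihood_measurable => k.
by apply: mv; rewrite -ltnS.
Qed.

Section process.
Variable x : nat -> Omega -> R.
Hypotheses (mx : forall i, measurable_fun setT (x i)) (xZ : forall i w, Z (x i w))
  (x_indep : indep Q (sigma_gen [set t | (t <= T)%N] x)
                     (sigma_gen_vec [set t | (t <= T)%N] y)).

Local Notation gen t := (sigma_gen_vec [set s | (s <= t)%N] y `|` P.-negligible).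

Let filtration_measurable t : <<s gen t >> `<=` @measurable _ Omega.
Proof.
by apply: completion_measurable => //; exact: sigma_gen_vec_measurable.
Qed.

Let filtration_indep t : (t <= T)%N ->
  indep Q (sigma_gen [set i | (i <= t)%N] x) <<s gen t >>.
Proof.
move=> tT; apply: indep_completion => //.
- exact: sigma_gen_vec_measurable.
- exact: sigma_gen_measurable.
move=> A B xA yB; apply: x_indep.
  by apply: sigma_gen_sub xA => i /= it; exact: leq_trans tT.
by apply: sigma_gen_sub yB => -[i k] /= it; exact: leq_trans tT.
Qed.

Let coord_measurable t i k : (i <= t)%N ->
  measurable_fun [set: g_sigma_algebraType (gen t)]
    ((fun w => y i w k ord0) : g_sigma_algebraType (gen t) -> R).
Proof.
move=> it; apply/sub_measurableP => B mB; apply: sub_sigma_algebra; left.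
apply: sub_sigma_algebra; exists (i, k) => //.
by exists B => //; rewrite setTI.
Qed.

Lemma Lambda_cond_expectation t : (t <= T)%N ->
  is_cond_expectation Q (filtration_vec P y t) (Lambda mu C y x t)
    (fun w => fine (\int[Q]_w' (Lam t (x ^~ w') w)%:E)).
Proof.
move=> tT; have [D [Di LD]] := Lambda_dominated tT.
have mL z : (forall i, Z (z i)) ->
    measurable_fun [set: g_sigma_algebraType (gen t)]
      (Lam t z : g_sigma_algebraType (gen t) -> R).
  by move=> zZ; apply: Lambda_measurable => i k it; exact: coord_measurable.
have uL w : uniformly_continuous_path Z t (Lam t ^~ w).
  by case: (Lambda_uniformly_continuous t w).
exact: (freezing_cond_expectation Zc Z0 mx xZ (@filtration_measurable t)
  (filtration_indep tT) mL LD uL Di).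
Qed.

Lemma coord_Lambda_cond_expectation t : (t <= T)%N ->
  is_cond_expectation Q (filtration_vec P y t)
    (fun w => x t w * Lambda mu C y x t w)
    (fun w => fine (\int[Q]_w' (x t w' * Lam t (x ^~ w') w)%:E)).
Proof.
move=> tT; have [D [Di LD]] := Lambda_dominated tT.
have [B B0 ZB] := compact_continuous_bounded Zc
  (fun x _ => @cvg_within _ (nbhs x) _ Z).
have mL z : (forall i, Z (z i)) ->
    measurable_fun [set: g_sigma_algebraType (gen t)]
      ((fun w => z t * Lam t z w) : g_sigma_algebraType (gen t) -> R).
  move=> zZ; apply: measurable_funM; first exact: measurable_cst.
  by apply: Lambda_measurable => i k it; exact: coord_measurable.
have LBD z w : (forall i, Z (z i)) -> `|z t * Lam t z w| <= B * D w.
  by move=> zZ; rewrite normrM ler_pM// ?ZB ?LD.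
have uL w : uniformly_continuous_path Z t (fun z => z t * Lam t z w).
  by case: (coord_Lambda_uniformly_continuous t w).
exact: (freezing_cond_expectation Zc Z0 mx xZ (@filtration_measurable t)
  (filtration_indep tT) mL LBD uL (integrableZl measurableT B Di)).
Qed.

(** Positivity holds at every [w], so the quotient of the closed forms is meaningful, and its limit
    can be taken, without an exceptional set. *)
Lemma Lambda_expectation_gt0 t w :
  0 < fine (\int[Q]_w' (Lam t (x ^~ w') w)%:E).
Proof.
have [ug [B B0 gB]] := Lambda_uniformly_continuous t w.
have mg := ucont_path_measurable Zc Z0 mx xZ ug.
rewrite fine_gt0// expectation_gt0//=; last first.
  by move=> w'; apply: Lambda_gt0.
rewrite ltey_eq; apply/orP; left.
exact: integrable_fin_num (path_integrable Q Zc Z0 mx xZ ug gB).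
Qed.

End process.

Lemma filter_expectation_cvg (xn : nat -> nat -> Omega -> R)
    (x : nat -> Omega -> R) t w :
  (forall n i, measurable_fun setT (xn n i)) -> (forall n i w, Z (xn n i w)) ->
  (forall i, measurable_fun setT (x i)) -> (forall i w, Z (x i w)) ->
  (forall i, (i <= t)%N -> cvg_in_probability Q (xn ^~ i) (x i)) ->
  fine (\int[Q]_w' (xn n t w' * Lam t (xn n ^~ w') w)%:E) /
    fine (\int[Q]_w' (Lam t (xn n ^~ w') w)%:E) @[n --> \oo] -->
  fine (\int[Q]_w' (x t w' * Lam t (x ^~ w') w)%:E) /
    fine (\int[Q]_w' (Lam t (x ^~ w') w)%:E).
Proof.
move=> mxn xnZ mx xZ xnx.
have gx (g : (nat -> R) -> R) : uniformly_continuous_path Z t g /\ bounded_path Z g ->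
    fine (\int[Q]_w' (g (xn n ^~ w'))%:E) @[n --> \oo] -->
    fine (\int[Q]_w' (g (x ^~ w'))%:E).
  move=> [ug [B B0 gB]].
  have cv := expectation_path_cvg Zc Z0 mxn xnZ mx xZ xnx ug gB.
  have gi := path_integrable Q Zc Z0 mx xZ ug gB.
  have fE := fineK (integrable_fin_num measurableT gi).
  by rewrite -fE in cv; case/fine_cvgP : cv.
apply: cvgM; first exact: (gx _ (coord_Lambda_uniformly_continuous t w)).
apply: cvgV; first by rewrite gt_eqF// Lambda_expectation_gt0.
exact: (gx _ (Lambda_uniformly_continuous t w)).
Qed.

End filter.

(** * Egorov's theorem and the passage from closed forms to versions of the filters *)

Lemma egorov_cvg0 d (T : measurableType d) (R : realType) (P : probability T R)
    (f : nat -> T -> R) (eps : R) : (forall n, measurable_fun setT (f n)) ->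
  (forall w, f n w @[n --> \oo] --> (0 : R)) -> 0 < eps ->
  exists B, [/\ measurable B, (P B < eps%:E)%E & forall e, 0 < e ->
    \forall n \near \oo, forall w, ~ B w -> `|f n w| < e].
Proof.
move=> mf f0 eps0.
have PT : (P setT < +oo)%E by rewrite probability_setT ltry.
have [B [mB PB Bu]] := pointwise_almost_uniform mf measurableT PT
  (fun w _ => f0 w) eps0.
exists B; split=> // e e0.
pose E : set (R * R) := [set p | ball p.1 e p.2].
have : nbhs (cst 0 : {uniform` [set: T] `\` B -> R})
    [set h : T -> R | forall w, ~ B w -> `|h w| < e].
  apply/uniform_nbhs; exists E; split; first exact: entourage_ball (PosNum e0).
  move=> h hE w nBw; have : E (0, h w) by exact: hE.
  by rewrite /E /ball/= sub0r normrN.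
by move=> /Bu.
Qed.

Lemma measurable_fun_div_gt0 d (T : measurableType d) (R : realType)
    (f g : T -> R) : measurable_fun setT f -> measurable_fun setT g ->
  (forall w, 0 < g w) -> measurable_fun setT (fun w => f w / g w).
Proof.
move=> mf mg g0; apply: measurable_funM => //.
(* Positivity of [g] gives 1/g = exp(-ln g), a composition of measurable functions. *)
have -> : (fun w => (g w)^-1) = (fun w => expR (- ln (g w))).
  by apply/funext => w; rewrite expRN lnK// posrE.
apply: measurableT_comp => //; apply: measurableT_comp => //.
by apply: measurableT_comp => //; exact: measurable_ln.
Qed.

Theorem theorem3 (R : realType) (d : measure_display) (Omega : measurableType d)
  (P : probability Omega R) (P_complete : measure_is_complete P)
  (N : nat) (N_gt0 : (0 < N)%N)
  (* state *)
  (Z : set R) (Z_compact : compact Z)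
  (X : nat -> {RV P >-> R})
  (X_ac : forall t, distribution P (X t) `<< lebesgue_measure)
  (X_Z : forall t, {ae P, forall w, Z (X t w)})
  (* observations *)
  (mu : nat -> R -> 'cV[R]_N) (Sigma : nat -> R -> 'M[R]_N)
  (sigma2 : R) (sigma2_ge0 : 0 <= sigma2)
  (D_Sigma : set 'M[R]_N) (D_Sigma_bounded : bounded_set D_Sigma)
  (Sigma_D : forall t x, Z x -> D_Sigma (Sigma t x))
  (Sigma_posdef : forall t x, Z x -> sym_posdef (Sigma t x))
  (Cov : nat -> R -> 'M[R]_N)
  (CovE : forall t x, Cov t x = Sigma t x + sigma2%:M)
  (u y : nat -> Omega -> 'cV[R]_N)
  (u_meas : forall t, random_vector (u t))
  (y_meas : forall t, random_vector (y t))
  (u_noise : std_gaussian_white_noise P [set: nat] u)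
  (u_indep : indep P (sigma_gen [set: nat] X) (sigma_gen_vec [set: nat] u))
  (yE : forall t w, Z (X t w) ->
     y t w = mu t (X t w) + sqrtmx (Cov t (X t w)) *m u t w)
  (* boundedness *)
  (lambda_inf_gt1 :
    (1 < ereal_inf [set (lambda_min (Cov t x))%:E | t in [set: nat] & x in Z])%E)
  (lambda_sup_lty :
    (ereal_sup [set (lambda_max (Cov t x))%:E | t in [set: nat] & x in Z] < +oo)%E)
  (mu_sup_lty :
    (ereal_sup [set (l2norm (mu t x))%:E | t in [set: nat] & x in Z] < +oo)%E)
  (* Lipschitz continuity *)
  (K_mu K_Sigma : R) (K_mu_ge0 : 0 <= K_mu) (K_Sigma_ge0 : 0 <= K_Sigma)
  (mu_lip : forall t x x', Z x -> Z x' ->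
     l2norm (mu t x - mu t x') <= K_mu * `|x - x'|)
  (Sigma_lip : forall t x x' (i j : 'I_N), Z x -> Z x' ->
     `|Sigma t x i j - Sigma t x' i j| <= K_Sigma * `|x - x'|)
  (* horizon, change of measure and state approximations *)
  (T : nat) (Pt : probability Omega R)
  (Pt_change : change_of_measure P mu Cov X y T Pt)
  (XA : nat -> nat -> {RV P >-> R})
  (XA_Z : forall A t, {ae P, forall w, Z (XA A t w)})
  (XA_indep : forall A, indep Pt (sigma_gen [set t | (t <= T)%N] (XA A))
                                 (sigma_gen_vec [set t | (t <= T)%N] y))
  (* the optimal and the approximate filters *)
  (EX : nat -> Omega -> R) (EA : nat -> nat -> Omega -> R)
  (EXP : forall t, (t <= T)%N ->
     is_cond_expectation P (filtration_vec P y t) (X t) (EX t))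
  (EAP : forall A t, (t <= T)%N ->
     is_filter_ratio P Pt mu Cov y (XA A) t (EA A t))
  (hyp : (forall t, (t <= T)%N ->
            Cweakly_convergent P (fun A => XA A t) (X t)) \/
         (forall t, (t <= T)%N ->
            cvg_in_probability P (fun A => XA A t) (X t)))
  (C : R) (C_ge1 : 1 <= C) :
  exists Omega_T : set Omega,
    [/\ measurable Omega_T,
        ((1 - T.+1%:R `^ (1 - C * N%:R) * expR (- (C * N%:R)))%:E <= P Omega_T)%E &
        (ereal_sup [set ereal_sup [set `|EA A t w - EX t w|%:E
                                  | w in Omega_T]
                   | t in [set t : nat | (t <= T)%N]]
           @[A --> \oo] --> 0)%E].


have [Pt_P P_Pt X_y_indep _ y_noise bayes] := Pt_change.
have [w0 Zw0] := ae_exists (X_Z 0%N).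
have Z0 : Z !=set0 by exists (X 0%N w0).
pose z0 := X 0%N w0.
have mZ : measurable Z by exact: compact_measurable.
have muc t i x : Z x -> mu t x' i ord0 @[x' --> within Z (nbhs x)] --> mu t x i ord0.
  move=> Zx; apply: (lipschitz_cvg_within K_mu_ge0 _ Zx) => x1 x2 Zx1 Zx2.
  apply: le_trans (mu_lip t _ _ Zx1 Zx2).
  by have := coord_le_l2norm (mu t x1 - mu t x2) i; rewrite !mxE.
have Covc t i j x : Z x -> Cov t x' i j @[x' --> within Z (nbhs x)] --> Cov t x i j.
  move=> Zx; apply: (lipschitz_cvg_within K_Sigma_ge0 _ Zx) => x1 x2 Zx1 Zx2.
  apply: le_trans (Sigma_lip t _ _ i j Zx1 Zx2).
  by rewrite !CovE !mxE opprD addrACA subrr addr0.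
have Covpos t x : Z x -> sym_posdef (Cov t x).
  by move=> Zx; rewrite CovE; apply: sym_posdefD_scalar => //; exact: Sigma_posdef.
(* By equivalence a [Pt]-negligible set is [P]-negligible, hence measurable. *)
have Pt_complete : measure_is_complete Pt.
  by move=> A /(negligible_null_dominates P_Pt); exact: P_complete.
pose ret := retract Z z0.
have mret : measurable_fun setT ret by exact: measurable_retract.
pose X' i w := ret (X i w).
pose XA' A i w := ret (XA A i w).
have mX' i : measurable_fun setT (X' i) by exact: measurableT_comp.
have mXA' A i : measurable_fun setT (XA' A i) by exact: measurableT_comp.
have X'Z i w : Z (X' i w) by exact: retract_in.
have XA'Z A i w : Z (XA' A i w) by exact: retract_in.
have X'E : {ae Pt, forall w, forall i, X i w = X' i w}.
  apply: ae_foralln => i; apply: (ae_null_dominates Pt_P).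
  by apply: filterS (X_Z i) => w Zw; rewrite /X' /ret retract_id.
have XA'E A : {ae Pt, forall w, forall i, XA A i w = XA' A i w}.
  apply: ae_foralln => i; apply: (ae_null_dominates Pt_P).
  by apply: filterS (XA_Z A i) => w Zw; rewrite /XA' /ret retract_id.
have X'_indep : indep Pt (sigma_gen [set t | (t <= T)%N] X')
    (sigma_gen_vec [set t | (t <= T)%N] y).
  by move=> A B /(sigma_gen_comp mret) xA; exact: X_y_indep.
have XA'_indep A : indep Pt (sigma_gen [set t | (t <= T)%N] (XA' A))
    (sigma_gen_vec [set t | (t <= T)%N] y).
  by move=> A1 B /(sigma_gen_comp mret) xA yB; exact: (XA_indep A _ _ xA yB).
(* In these closed forms [w] fixes the observations and the integration variable [w'] runs over the
   state. *)
pose num (x : nat -> Omega -> R) t w := fine (\int[Pt]_w'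
  (x t w' * Lambda mu Cov y (fun i _ => x i w') t w)%:E).
pose den (x : nat -> Omega -> R) t w := fine (\int[Pt]_w'
  (Lambda mu Cov y (fun i _ => x i w') t w)%:E).
have num_ce x := @coord_Lambda_cond_expectation _ _ _ P Pt N Z mu Cov y T
  P_complete Pt_P Z_compact Z0 muc Covc Covpos y_meas y_noise x.
have den_ce x := @Lambda_cond_expectation _ _ _ P Pt N Z mu Cov y T
  P_complete Pt_P Z_compact Z0 muc Covc Covpos y_meas y_noise x.
have filt_meas t : filtration_vec P y t `<=` measurable.
  by apply: completion_measurable => //; exact: sigma_gen_vec_measurable.
have EXE t : (t <= T)%N -> {ae P, forall w, EX t w = num X' t w / den X' t w}.
  (* Bayes' formula accepts any versions of numerator and denominator, so it takes the closed forms,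
     computed for the retracted state and carried back to [X] almost surely. *)
  move=> tT; apply: (bayes t _ _ tT (EXP t tT)).
  exists (num X' t), (den X' t); split.
  - apply: (cond_expectation_ae_eq (filt_meas t) Pt_complete
      (num_ce X' mX' X'Z X'_indep t tT)).
    apply: filterS X'E => w XX'; rewrite /Lambda XX'; congr (_ * _).
    by apply: eq_bigr => i _; rewrite XX'.
  - apply: (cond_expectation_ae_eq (filt_meas t) Pt_complete
      (den_ce X' mX' X'Z X'_indep t tT)).
    apply: filterS X'E => w XX'; rewrite /Lambda.
    by apply: eq_bigr => i _; rewrite XX'.
  - exact: aeW.
have EAE A t : (t <= T)%N ->
    {ae P, forall w, EA A t w = num (XA' A) t w / den (XA' A) t w}.
  move=> tT; apply: (ae_null_dominates P_Pt).
  (* Here the versions are imposed; uniqueness of conditional expectations identifies them with the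
     closed forms. *)
  have [nu [de [nuP deP EAnd]]] := EAP A t tT.
  have nuE := cond_expectation_ae_unique (filt_meas t) nuP
    (num_ce (XA' A) (mXA' A) (XA'Z A) (XA'_indep A) t tT).
  have deE := cond_expectation_ae_unique (filt_meas t) deP
    (den_ce (XA' A) (mXA' A) (XA'Z A) (XA'_indep A) t tT).
  have {}nuE : {ae Pt, forall w, nu w = num (XA' A) t w}.
    apply: nuE; apply: filterS (XA'E A) => w XX'; rewrite /Lambda XX'; congr (_ * _).
    by apply: eq_bigr => i _; rewrite XX'.
  have {}deE : {ae Pt, forall w, de w = den (XA' A) t w}.
    apply: deE; apply: filterS (XA'E A) => w XX'; rewrite /Lambda.
    by apply: eq_bigr => i _; rewrite XX'.
  by apply: filterS3 EAnd nuE deE => w -> -> ->.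
have hypP t : (t <= T)%N -> cvg_in_probability P (fun A => XA A t) (X t).
  case: hyp => [XAX tT|]; last exact.
  exact: (Cweak_cvg_in_probability Z_compact (fun A => measurable_funPT (XA A t))
    (measurable_funPT (X t)) (X_Z t) (XAX t tT)).
have XA'X' t : (t <= T)%N -> cvg_in_probability Pt (fun A => XA' A t) (X' t).
  move=> tT; apply: (@cvg_in_probability_ae _ _ _ Pt (fun A => XA A t) _ (X t)) => //.
  - by move=> A; apply: filterS (XA'E A) => w ->.
  - by apply: filterS X'E => w ->.
  (* The convergence is known under [P]; domination of [Pt] by [P] carries it over for each
     threshold [e]. *)
  move=> e e0; apply: (null_dominates_cvg0 Pt_P _ (hypP t tT e e0)) => A.
  exact: measurable_dist_ge.
have den_gt0 x t w : (forall i, measurable_fun setT (x i)) -> (forall i w, Z (x i w)) ->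
    0 < den x t w.
  move=> mx xZ.
  exact: (@Lambda_expectation_gt0 _ _ _ Pt N Z mu Cov y Z_compact Z0 muc Covc Covpos).
have mratio x t : (t <= T)%N -> (forall i, measurable_fun setT (x i)) ->
    (forall i w, Z (x i w)) ->
    indep Pt (sigma_gen [set t | (t <= T)%N] x) (sigma_gen_vec [set t | (t <= T)%N] y) ->
    measurable_fun setT (fun w => num x t w / den x t w).
  move=> tT mx xZ xy.
  have [_ /measurable_int/measurable_EFinP mn _ _] := num_ce x mx xZ xy t tT.
  have [_ /measurable_int/measurable_EFinP md _ _] := den_ce x mx xZ xy t tT.
  by apply: measurable_fun_div_gt0 => // w; exact: den_gt0.
have ratio_cvg t w : (t <= T)%N -> num (XA' A) t w / den (XA' A) t w @[A --> \oo] -->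
    num X' t w / den X' t w.
  move=> tT.
  apply: (@filter_expectation_cvg _ _ _ Pt N Z mu Cov y Z_compact Z0 muc Covc Covpos
    XA' X' t w mXA' XA'Z mX' X'Z) => i it.
  exact/XA'X'/(leq_trans it).
(* Summing over the finite horizon gives a single sequence that dominates the error at every t <= T,
   so one use of Egorov's theorem handles all times. *)
pose err A w := \sum_(t < T.+1)
  `|num (XA' A) t w / den (XA' A) t w - num X' t w / den X' t w|.
have merr A : measurable_fun setT (err A).
  apply: measurable_sum => t; apply: measurableT_comp => //.
  have tT : (t <= T)%N by rewrite -ltnS.
  by apply: measurable_funB; exact: mratio.
have err_cvg w : err A w @[A --> \oo] --> (0 : R).
  have E0 : \sum_(t < T.+1) (0 : R) = 0 by rewrite big1.
  rewrite -[X in _ --> X]E0.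
  apply: (@cvg_big R _ +%R) => [|t _]; first exact: add_continuous.
  have tT : (t <= T)%N by rewrite -ltnS.
  rewrite -(normr0 R) -(subrr (num X' t w / den X' t w)).
  by apply: cvg_norm; apply: cvgB; [exact: ratio_cvg|exact: cvg_cst].
pose p0 := T.+1%:R `^ (1 - C * N%:R) * expR (- (C * N%:R)).
have p00 : 0 < p0 by rewrite mulr_gt0 ?expR_gt0// powR_gt0.
(* The bound 1 / 2 makes the good set nonempty: the supremum over the empty set
   is -oo. *)
pose eps := Num.min p0 (1 / 2).
have eps0 : 0 < eps by rewrite lt_min p00 divr_gt0.
have [B [mB PB Bu]] := egorov_cvg0 P merr err_cvg eps0.
(* One null set serves all times and all resolutions, as there are countably many of them. *)
have [M [mM PM EM]] : {ae P, forall w, forall t, (t <= T)%N ->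
    EX t w = num X' t w / den X' t w /\
    forall A, EA A t w = num (XA' A) t w / den (XA' A) t w}.
  apply: ae_foralln => t; have [tT|tT] := leqP t T; last first.
    by apply: aeW.
  have := ae_foralln (fun A => EAE A t tT).
  by apply: filterS2 (EXE t tT) => w EXw EAw _; split.
have mBM : measurable (B `|` M) by exact: measurableU.
have PBM : (P (B `|` M) < eps%:E)%E by rewrite measureU0.
have OmegaE w : (~` (B `|` M)) w -> ~ B w /\ forall t, (t <= T)%N ->
    EX t w = num X' t w / den X' t w /\
    forall A, EA A t w = num (XA' A) t w / den (XA' A) t w.
  move=> nBM; split; first by move=> Bw; apply: nBM; left.
  by apply: contrapT => nE; apply: nBM; right; exact: EM.
have POmega : ((1 - eps)%:E <= P (~` (B `|` M)))%E.
  rewrite probability_setC// EFinB leeB//; exact: ltW.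
exists (~` (B `|` M)); split.
- exact: measurableC.
- apply: le_trans POmega; rewrite lee_fin lerB// -/p0.
  by rewrite ge_min lexx.
have [w1 Ow1] : (~` (B `|` M)) !=set0.
  apply/set0P/negP => /eqP OE; move: POmega; rewrite OE measure0 lee_fin.
  rewrite subr_le0 leNgt => /negP; apply.
  by rewrite gt_min [1 / 2 < 1](_ : _ = true) ?orbT//; lra.
pose U A := ereal_sup [set ereal_sup [set `|EA A t w - EX t w|%:E
  | w in ~` (B `|` M)] | t in [set t : nat | (t <= T)%N]].
have U_ge0 A : (0 <= U A)%E.
  apply: (@le_trans _ _ `|EA A 0%N w1 - EX 0%N w1|%:E); first by rewrite lee_fin.
  apply: (@le_trans _ _ (ereal_sup [set `|EA A 0%N w - EX 0%N w|%:E
    | w in ~` (B `|` M)])).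
    by apply: ereal_sup_ubound; exists w1.
  by apply: ereal_sup_ubound; exists 0%N.
have U_le e : 0 < e -> \forall A \near \oo, (U A <= e%:E)%E.
  move=> e0; apply: filterS (Bu e e0) => A Be.
  apply: ge_ereal_sup => _ [t tT <-]; apply: ge_ereal_sup => _ [w Ow <-].
  have [nBw EE] := OmegaE w Ow; have [-> ->] := EE t tT.
  rewrite lee_fin; apply: le_trans (ltW (Be w nBw)).
  apply: le_trans (ler_norm _).
  by rewrite /err/= (bigD1 (Ordinal (tT : (t < T.+1)%N)))//= lerDl sumr_ge0.
suff : U A @[A --> \oo] --> 0%E by [].
apply/fine_cvgP; split.
  apply: filterS (U_le 1 ltr01) => A UA.
  by rewrite ge0_fin_numE//; exact: (le_lt_trans UA (ltry _)).
apply/cvgrPdist_le => e e0; apply: filterS (U_le e e0) => A UA /=.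
rewrite sub0r normrN ger0_norm ?fine_ge0//.
rewrite -lee_fin fineK// ge0_fin_numE//; exact: (le_lt_trans UA (ltry _)).
Qed.
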